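(* Consider a Runge--Kutta resonance-based scheme, either for the KdV equation or for the cubic NLSE with $\mu\neq0$, with coefficients $S\in\mathbb{N}$, $c_q\in[0,1]$, $b^{p,q,r},a_{p,q,r}^{\tilde p,\tilde q,\tilde r}\in\mathbb{R}$. If the scheme is consistent and $$b^{\tilde p,\tilde q,\tilde r}\,b^{p,q,r}=b^{p,q,r}\,a_{p,q,r}^{\tilde p,\tilde q,\tilde r}+b^{\tilde p,\tilde q,\tilde r}\,a_{\tilde p,\tilde q,\tilde r}^{p,q,r}\qquad\text{for all }0\le p,q,r,\tilde p,\tilde q,\tilde r\le S,$$ then the scheme is implicit.
   Context: $\mathbb{T}=\mathbb{R}/(2\pi\mathbb{Z})$, $\hat u_m=\frac1{2\pi}\int_{\mathbb T}e^{-imx}u(x)\,\mathrm{d}x$. KdV: $\partial_tu+\partial_x^3u=\frac12\partial_x(u^2)$ on $\mathbb{T}$; real-valued zero-mean functions. With $$\mathcal F^{[KdV]}_p(\tau;c;w)=\frac12\sum_{m\in\mathbb Z}e^{imx}\frac1{\tau^{p+1}}\sum_{a+b=m}\int_0^{c\tau}im\,e^{-3ismab}s^p\,\mathrm{d}s\,\hat w_a\hat w_b ,$$ the KdV scheme is $$u^{n+1}=e^{-\tau\partial_x^3}u^n+\tau\sum_{p,q,r=0}^Sb^{p,q,r}e^{-\tau\partial_x^3}K_{p,q,r},\qquad K_{p,q,r}=\mathcal F^{[KdV]}_p\Big(\tau;c_q;u^n+\tau\sum_{\tilde p,\tilde q,\tilde r=0}^Sa_{p,q,r}^{\tilde p,\tilde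 q,\tilde r}K_{\tilde p,\tilde q,\tilde r}\Big).$$ NLSE: $i\partial_tu=-\partial_x^2u+\mu|u|^2u$ on $\mathbb{T}$. Fix $\sigma\ge1$ and distinct nodes $0\le\gamma_1<\dots<\gamma_\sigma\le1$; $\mathcal P_\sigma[f]$ is the polynomial of degree at most $\sigma-1$ with $\mathcal P_\sigma[f](\tau\gamma_j)=f(\tau\gamma_j)$. Set $$\mathcal K_{2\sigma}(s;k,k_1,k_2,k_3)=e^{-2iskk_1}\mathcal P_\sigma[e^{2i\,\cdot\,k_2k_3}](s)+e^{2isk_2k_3}\mathcal P_\sigma[e^{-2i\,\cdot\,kk_1}](s)-\mathcal P_\sigma[e^{2i\,\cdot\,k_2k_3}](s)\,\mathcal P_\sigma[e^{-2i\,\cdot\,kk_1}](s),$$ $$\mathcal F^{[NLSE,2\sigma]}_p(\tau;c;w)=-i\mu\sum_{k\in\mathbb Z}e^{ikx}\sum_{k+k_1=k_2+k_3}\frac1{\tau^{p+1}}\int_0^{c\tau}\mathcal K_{2\sigma}(s;k,k_1,k_2,k_3)s^p\,\mathrm{d}s\,\overline{\hat w_{k_1}}\hat w_{k_2}\hat w_{k_3}.$$ The NLSE scheme is $$u^{n+1}=e^{i\tau\partial_x^2}u^n+\tau\sum_{p,q,r=0}^Sb^{p,q,r}e^{i\tau\partial_x^2}K_{p,q,r},\qquad K_{p,q,r}=\mathcal F^{[NLSE,2\sigma]}_p\Big(\tau;c_q;u^n+\tau\sum_{\tilde p,\tilde q,\tilde r=0}^Sa_{p,q,r}^{\tilde p,\tilde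 q,\tilde r}K_{\tilde p,\tilde q,\tilde r}\Big).$$ Consistent: for every smooth solution $u(t)$ of the equation on some interval $[0,T]$, $T>0$, one step of the scheme started from $u^0=u(0)$ gives $u^1$ with $\|u(\tau)-u^1\|_{L^2}=o(\tau)$ as $\tau\to0^+$. Explicit: the stages can be ordered so that each $K_{p,q,r}$ depends only on strictly preceding stages, i.e. the matrix $(a_{p,q,r}^{\tilde p,\tilde q,\tilde r})$ (rows $(p,q,r)$, columns $(\tilde p,\tilde q,\tilde r)$) is strictly lower triangular for some ordering of the index triples. Implicit: not explicit. *)

(* Defs.v *)
From Stdlib Require Export Reals ZArith List.
From Coquelicot Require Export Coquelicot.
Open Scope R_scope.

(** * Unordered sums and Fourier series

    Functions on the torus are 2π-periodic functions [R -> C]. *)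

(* Unconditional (for complex series: absolute) convergence, along the finite
   subsets of [{i | P i}] ordered by inclusion, of the sum of [f] to [l]. *)
Definition has_sum {I : Type} (P : I -> Prop) (f : I -> C) (l : C) : Prop :=
  forall eps : R, 0 < eps ->
  exists L0 : list I, (forall i, In i L0 -> P i) /\
  forall L : list I, NoDup L -> (forall i, In i L -> P i) -> incl L0 L ->
    Cmod (fold_right Cplus (RtoC 0) (map f L) - l)%C < eps.

(* exp (i θ) *)
Definition expi (theta : R) : C := (cos theta, sin theta).

Definition CInt (f : R -> C) (x y : R) : C :=
  @RInt C_R_CompleteNormedModule f x y.

Definition fourier (u : R -> C) (m : Z) : C :=
  (RtoC (/ (2 * PI)) * CInt (fun x => expi (- (IZR m * x)) * u x) 0 (2 * PI))%C.

Definition L2norm (u : R -> C) : R :=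
  sqrt (RInt (fun x => (Cmod (u x)) ^ 2) 0 (2 * PI)).

(* [v = exp(i phase(-i∂x)) u], i.e. the Fourier multiplier with symbol
   [exp (i phase(m))]. *)
Definition unitary_multiplier (phase : Z -> R) (u v : R -> C) : Prop :=
  forall x, has_sum (fun _ : Z => True)
    (fun m => expi (IZR m * x) * expi (phase m) * fourier u m)%C (v x).

(** * Smooth solutions *)

(* [D j k] is the partial derivative ∂t^j ∂x^k u on [0,T] × R; all of them are
   jointly continuous there, and ∂t is one-sided at the two end times. *)
Definition smooth_with_derivatives (T : R) (u : R -> R -> C)
    (D : nat -> nat -> R -> R -> C) : Prop :=
  (forall t x, 0 <= t <= T -> D 0%nat 0%nat t x = u t x) /\
  (forall j k t x, 0 <= t <= T ->
     @filterdiff R_AbsRing R_NormedModule C_R_NormedModule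
       (fun s => D j k s x) (within (fun s => 0 <= s <= T) (locally t))
       (fun h => @scal R_AbsRing C_R_NormedModule h (D (j + 1)%nat k t x)) /\
     @is_derive R_AbsRing C_R_NormedModule
       (fun y => D j k t y) x (D j (k + 1)%nat t x) /\
     filterlim (fun z : R * R => D j k (fst z) (snd z))
       (within (fun z : R * R => 0 <= fst z <= T) (locally (t, x)))
       (locally (D j k t x))).

Definition space_periodic (T : R) (u : R -> R -> C) : Prop :=
  forall t x, 0 <= t <= T -> u t (x + 2 * PI) = u t x.

Definition KdV_smooth_solution (T : R) (u : R -> R -> C) : Prop :=
  space_periodic T u /\
  (forall t x, 0 <= t <= T -> Im (u t x) = 0) /\
  (forall t, 0 <= t <= T -> CInt (u t) 0 (2 * PI) = RtoC 0) /\
  exists D, smooth_with_derivatives T u D /\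
    forall t x, 0 <= t <= T ->
    exists du2 : C,
      @is_derive R_AbsRing C_R_NormedModule (fun y => u t y * u t y)%C x du2 /\
      (D 1%nat 0%nat t x + D 0%nat 3%nat t x = RtoC (1 / 2) * du2)%C.

Definition NLSE_smooth_solution (mu T : R) (u : R -> R -> C) : Prop :=
  space_periodic T u /\
  exists D, smooth_with_derivatives T u D /\
    forall t x, 0 <= t <= T ->
      (Ci * D 1%nat 0%nat t x =
         - D 0%nat 2%nat t x + RtoC (mu * (Cmod (u t x)) ^ 2) * u t x)%C.

(** * Runge--Kutta resonance-based schemes *)

Definition stage : Type := (nat * nat * nat)%type.

Definition is_stage (S : nat) (i : stage) : Prop :=
  let '(p, q, r) := i in (p <= S)%nat /\ (q <= S)%nat /\ (r <= S)%nat.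

Definition stage_sum (S : nat) (f : stage -> C) : C :=
  @sum_n C_AbelianMonoid (fun p =>
    @sum_n C_AbelianMonoid (fun q =>
      @sum_n C_AbelianMonoid (fun r => f (p, q, r)) S) S) S.

(* [E tau u v] means that the linear flow for time [tau] maps [u] to [v];
   [F p tau c w k] means that [F_p(tau; c; w) = k].  Both are relations, because
   they are given by series which have to converge.  The row of the matrix [a]
   is its first argument. *)
Definition RK_step (E : R -> (R -> C) -> (R -> C) -> Prop)
    (F : nat -> R -> R -> (R -> C) -> (R -> C) -> Prop)
    (S : nat) (c : nat -> R) (b : stage -> R) (a : stage -> stage -> R)
    (tau : R) (u0 u1 : R -> C) : Prop :=
  exists (K EK : stage -> R -> C) (Eu0 : R -> C),
    (forall p q r, is_stage S (p, q, r) ->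
       F p tau (c q)
         (fun x => u0 x + RtoC tau *
            stage_sum S (fun j => RtoC (a (p, q, r) j) * K j x))%C
         (K (p, q, r))) /\
    E tau u0 Eu0 /\
    (forall i, is_stage S i -> E tau (K i) (EK i)) /\
    (forall x, u1 x =
       (Eu0 x + RtoC tau * stage_sum S (fun i => RtoC (b i) * EK i x))%C).

(* For every smooth solution the scheme can be run for one step of every
   sufficiently small size, with an output whose error is o(tau). *)
Definition consistent (solution : R -> (R -> R -> C) -> Prop)
    (step : R -> (R -> C) -> (R -> C) -> Prop) : Prop :=
  forall (T : R) (u : R -> R -> C), 0 < T -> solution T u ->
  exists u1 : R -> R -> C,
    at_right 0 (fun tau => step tau (u 0) (u1 tau)) /\
    filterlim (fun tau => L2norm (fun x => u tau x - u1 tau x)%C / tau)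
      (at_right 0) (locally 0).

Definition explicit_scheme (S : nat) (a : stage -> stage -> R) : Prop :=
  exists order : list stage,
    NoDup order /\ (forall i, In i order <-> is_stage S i) /\
    forall m n i j, nth_error order m = Some i -> nth_error order n = Some j ->
      (m <= n)%nat -> a i j = 0.

Definition implicit_scheme (S : nat) (a : stage -> stage -> R) : Prop :=
  ~ explicit_scheme S a.

(** ** KdV *)

(* exp(-tau ∂x^3) has symbol exp(-tau (i m)^3) = exp(i tau m^3). *)
Definition KdV_flow (tau : R) : (R -> C) -> (R -> C) -> Prop :=
  unitary_multiplier (fun m => tau * IZR m ^ 3).

Definition KdV_F (p : nat) (tau c : R) (w k : R -> C) : Prop :=
  exists coef : Z -> C,
    (forall m : Z,
       has_sum (fun ab : Z * Z => (fst ab + snd ab)%Z = m)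
         (fun ab => let '(a, b) := ab in
            RtoC (/ tau ^ (p + 1)) *
            CInt (fun s => Ci * RtoC (IZR m) *
                    expi (- (3 * s * IZR m * IZR a * IZR b)) * RtoC (s ^ p))
                 0 (c * tau) *
            fourier w a * fourier w b)%C
         (coef m)) /\
    (forall x, exists l : C,
       has_sum (fun _ : Z => True) (fun m => expi (IZR m * x) * coef m)%C l /\
       k x = (RtoC (1 / 2) * l)%C).

Definition KdV_consistent (S : nat) (c : nat -> R) (b : stage -> R)
    (a : stage -> stage -> R) : Prop :=
  consistent KdV_smooth_solution (RK_step KdV_flow KdV_F S c b a).

(** ** Cubic NLSE *)

Definition is_node_family (sigma : nat) (gamma : nat -> R) : Prop :=
  (1 <= sigma)%nat /\
  (forall j, (1 <= j <= sigma)%nat -> 0 <= gamma j <= 1) /\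
  (forall i j, (1 <= i)%nat -> (i < j)%nat -> (j <= sigma)%nat ->
     gamma i < gamma j).

(* [P f] is the polynomial of degree at most [sigma - 1] which agrees with [f]
   at the nodes [tau * gamma j]; these conditions determine [P f] on R when the
   nodes are distinct and [tau <> 0]. *)
Definition is_interpolation (sigma : nat) (gamma : nat -> R) (tau : R)
    (P : (R -> C) -> R -> C) : Prop :=
  forall f : R -> C,
    (exists coef : nat -> C, forall s,
       P f s = @sum_n C_AbelianMonoid
                 (fun l => coef l * RtoC (s ^ l))%C (sigma - 1)) /\
    (forall j, (1 <= j <= sigma)%nat -> P f (tau * gamma j) = f (tau * gamma j)).

Definition NLSE_kernel (P : (R -> C) -> R -> C) (s : R) (k k1 k2 k3 : Z) : C :=
  let e23 := fun t => expi (2 * t * IZR k2 * IZR k3) in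
  let e01 := fun t => expi (- (2 * t * IZR k * IZR k1)) in
  (e01 s * P e23 s + e23 s * P e01 s - P e23 s * P e01 s)%C.

(* exp(i tau ∂x^2) has symbol exp(i tau (i m)^2) = exp(-i tau m^2). *)
Definition NLSE_flow (tau : R) : (R -> C) -> (R -> C) -> Prop :=
  unitary_multiplier (fun m => - (tau * IZR m ^ 2)).

Definition NLSE_F (mu : R) (sigma : nat) (gamma : nat -> R)
    (p : nat) (tau c : R) (w out : R -> C) : Prop :=
  exists (P : (R -> C) -> R -> C) (coef : Z -> C),
    is_interpolation sigma gamma tau P /\
    (forall k : Z,
       has_sum (fun h : Z * Z * Z =>
                  let '(k1, k2, k3) := h in (k + k1 = k2 + k3)%Z)
         (fun h => let '(k1, k2, k3) := h in
            RtoC (/ tau ^ (p + 1)) *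
            CInt (fun s => NLSE_kernel P s k k1 k2 k3 * RtoC (s ^ p))
                 0 (c * tau) *
            Cconj (fourier w k1) * fourier w k2 * fourier w k3)%C
         (coef k)) /\
    (forall x, exists l : C,
       has_sum (fun _ : Z => True) (fun k => expi (IZR k * x) * coef k)%C l /\
       out x = (- Ci * RtoC mu * l)%C).

Definition NLSE_consistent (mu : R) (sigma : nat) (gamma : nat -> R)
    (S : nat) (c : nat -> R) (b : stage -> R) (a : stage -> stage -> R) : Prop :=
  consistent (NLSE_smooth_solution mu)
    (RK_step NLSE_flow (NLSE_F mu sigma gamma) S c b a).

(* Main.v *)
Require Import Defs.
From Stdlib Require Import Lra Lia Psatz FinFun.
From Stdlib Require Import Classical FunctionalExtensionality.

(* In an explicit scheme [a i i = 0], so the symplecticity condition with equal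
   indices gives [b i ^ 2 = 0]: one step is the linear flow alone. It remains to
   find a smooth solution which the linear flow does not follow to first order.

   For the NLSE this is the plane wave [exp (- i mu t)], whose initial value is
   fixed by the linear flow.

   For KdV it is a cnoidal wave [phi (x - v t)]. Write [phi^_m] for the Fourier
   coefficients of [phi]. Comparing the [m]-th coefficients of the wave and of
   the linear flow to first order in time gives [m (m ^ 2 + v) phi^_m = 0], so
   only two opposite frequencies [n], [- n] with [n ^ 2 = - v] can occur. On
   these the linear flow is a translation at speed [v], so the L2 error does not
   depend on time and hence vanishes; thus [phi] is a sinusoid, which contradicts
   the quadratic equation satisfied by [phi]. *)

(** * Scalar autonomous equations and elliptic functions *)

(** KdV offers few elementary test solutions: a zero-mean constant is zero, and a nonzero sinusoid
    is not a solution because squaring it creates the second harmonic. Arbitrary smooth data would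
    call for existence theory, so a periodic travelling wave is built by quadrature, and all its
    derivatives come from algebra in three elliptic functions. Its speed [v] contains the mean of
    [s ^ 2], an integral that is never evaluated, so [- v] might be the square of an integer; this
    is why two frequencies survive the first-order comparison. That the other coefficients vanish
    would determine the wave only through completeness of the exponentials; a second use of the
    o(tau) error, on the remainder, replaces that theorem. The output of the linear flow is known
    only through pointwise convergent series, so its Fourier coefficients have to be recovered; the
    decay [/ m ^ 2] of the data makes the convergence uniform. *)

Lemma continuous_ex_RInt (f : R -> R) (x y : R) :
  (forall z, continuous f z) -> ex_RInt f x y.
Proof. intros H. apply (ex_RInt_continuous (V := R_CompleteNormedModule)). intros z _. apply H. Qed.

Lemma is_derive_RInt_continuous (f : R -> R) (x y : R) :
  (forall z, continuous f z) -> is_derive (RInt f x) y (f y).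
Proof.
  intros H. apply (is_derive_RInt f (RInt f x) x y); [|apply H].
  apply filter_forall. intros z. apply (RInt_correct (V := R_CompleteNormedModule)).
  now apply continuous_ex_RInt.
Qed.

Lemma is_derive_continuous (f : R -> R) (x l : R) : is_derive f x l -> continuous f x.
Proof. intros H. apply (ex_derive_continuous f). now exists l. Qed.

Lemma is_derive_eq (f : R -> R) (x l l' : R) : is_derive f x l -> l = l' -> is_derive f x l'.
Proof. now intros H <-. Qed.

Lemma MVT_everywhere (f df : R -> R) :
  (forall x, is_derive f x (df x)) ->
  forall x y, exists z, Rmin x y <= z <= Rmax x y /\ f y - f x = df z * (y - x).
Proof.
  intros H x y. apply (MVT_gen f x y df).
  - intros z _. apply H.
  - intros z _. apply continuity_pt_filterlim. eapply is_derive_continuous. apply H.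
Qed.

(** The integral over a window of length [p] has derivative [f (z + p) - f z = 0] in the left end
    [z]. *)
Lemma RInt_periodic_shift (f : R -> R) (p : R) :
  (forall x, continuous f x) -> (forall x, f (x + p) = f x) ->
  forall x, RInt f x (x + p) = RInt f 0 p.
Proof.
  intros Hc Hp x.
  set (F := fun z => RInt f 0 (z + p) - RInt f 0 z).
  assert (HF : forall z, is_derive F z 0).
  { intros z. unfold F.
    apply is_derive_eq with (1 * f (z + p) - f z); [|rewrite Hp; ring].
    apply (is_derive_minus (K := R_AbsRing) (V := R_NormedModule)).
    - apply (is_derive_comp (RInt f 0) (fun z => z + p)).
      + now apply is_derive_RInt_continuous.
      + auto_derive; [easy|ring].
    - now apply is_derive_RInt_continuous. }
  destruct (MVT_everywhere F (fun _ => 0) HF 0 x) as [z [_ Hz]].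
  assert (E := RInt_Chasles f 0 x (x + p) (continuous_ex_RInt f _ _ Hc) (continuous_ex_RInt f _ _ Hc)).
  unfold plus in E; simpl in E. unfold F in Hz.
  rewrite Rplus_0_l, (RInt_point 0 f) in Hz. unfold zero in Hz; simpl in Hz. lra.
Qed.

(* The solution is the inverse of the primitive of [/ g], which has slope at
   least 1. *)
Lemma autonomous_flow (g : R -> R) (p : R) :
  (forall x, 0 < g x <= 1) -> (forall x, continuous g x) ->
  0 < p -> (forall x, g (x + p) = g x) ->
  exists (theta : R -> R) (q : R), 0 < q /\
    (forall x, is_derive theta x (g (theta x))) /\
    (forall x, theta (x + q) = theta x + p) /\
    (forall y, exists x, theta x = y).
Proof.
  intros Hg Hc Hp Hper.
  assert (Hci : forall x, continuous (fun x => / g x) x).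
  { intros x. apply (continuous_comp g Rinv); [apply Hc|].
    apply continuous_Rinv. generalize (Hg x); lra. }
  set (G := RInt (fun x => / g x) 0).
  assert (HG : forall x, is_derive G x (/ g x))
    by (intros; now apply (is_derive_RInt_continuous (fun x => / g x))).
  assert (Hgi : forall x, 1 <= / g x).
  { intros x. rewrite <- Rinv_1 at 1. apply Rinv_le_contravar; apply Hg. }
  assert (HG0 : G 0 = 0) by exact (RInt_point 0 (fun x => / g x)).
  assert (Hmvt := MVT_everywhere G (fun x => / g x) HG).
  assert (Hsurj : forall y, {x | G x = y}).
  { intros y.
    assert (G (Rmin 0 y) <= y <= G (Rmax 0 y)).
    { destruct (Hmvt 0 y) as [z [_ Hz]]. specialize (Hgi z).
      unfold Rmin, Rmax. destruct (Rle_dec 0 y); rewrite ?HG0 in *; nra. }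
    destruct (IVT_gen G (Rmin 0 y) (Rmax 0 y) y) as [x [_ Hx]].
    - intros x. apply continuity_pt_filterlim. eapply is_derive_continuous. apply HG.
    - now rewrite Rmin_left, Rmax_right by lra.
    - now exists x. }
  set (theta := fun y => proj1_sig (Hsurj y)).
  assert (Ht : forall y, G (theta y) = y) by (intros y; apply (proj2_sig (Hsurj y))).
  assert (Hinj : forall x y, G x = G y -> x = y).
  { intros x y E. destruct (Hmvt x y) as [z [_ Hz]]. specialize (Hgi z).
    assert (/ g z * (y - x) = 0) by lra. nra. }
  (* [G p] is the time in which [theta] crosses one period of [g]. *)
  exists theta, (G p). split; [|split; [|split]].
  - destruct (Hmvt 0 p) as [z [_ Hz]]. specialize (Hgi z). nra.
  - intros x. apply is_derive_Reals. intros eps Heps.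
    destruct (proj1 (filterlim_locally g (g (theta x))) (Hc (theta x)) (mkposreal eps Heps))
      as [delta Hdelta].
    exists delta. intros h Hh Hhd.
    (* The increment of [theta] is [g z * h] for some [z] between the two values of [theta]. As
       [g <= 1], this [z] is within [|h|] of [theta x], and continuity of [g] gives the
       derivative. *)
    destruct (Hmvt (theta x) (theta (x + h))) as [z [Hz E]].
    rewrite !Ht in E.
    assert (Hgz := Hg z).
    assert (E' : theta (x + h) - theta x = g z * h).
    { replace h with (x + h - x) at 2 by ring. rewrite E. field. lra. }
    replace ((theta (x + h) - theta x) / h) with (g z)
      by (rewrite E'; field; easy).
    apply (Hdelta z).
    change (Rabs (z - theta x) < delta).
    apply Rle_lt_trans with (2 := Hhd).
    apply Rle_trans with (Rabs (theta (x + h) - theta x)).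
    + revert Hz. unfold Rmin, Rmax, Rabs.
      destruct Rle_dec; repeat destruct Rcase_abs; lra.
    + rewrite E', Rabs_mult, (Rabs_pos_eq (g z)) by lra.
      assert (H := Rabs_pos h). nra.
  - intros x. apply Hinj. rewrite Ht.
    assert (E := RInt_Chasles (fun x => / g x) 0 (theta x) (theta x + p)
      (continuous_ex_RInt _ _ _ Hci) (continuous_ex_RInt _ _ _ Hci)).
    rewrite (RInt_periodic_shift (fun x => / g x)) in E;
      [|easy|intros; now rewrite Hper].
    unfold plus in E; simpl in E. fold (G p) (G (theta x)) (G (theta x + p)) in E.
    rewrite Ht in E. easy.
  - intros y. exists (G y). apply Hinj. apply Ht.
Qed.

(* The Jacobi functions [sn], [cn], [dn] of modulus [sqrt (1 / 2)], rescaled. *)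
Lemma elliptic_functions :
  exists (lam : R) (s c d : R -> R), 0 < lam /\
    (forall x, is_derive s x (lam * c x * d x)) /\
    (forall x, is_derive c x (- lam * s x * d x)) /\
    (forall x, is_derive d x (- lam / 2 * s x * c x)) /\
    (forall x, s x ^ 2 + c x ^ 2 = 1) /\
    (forall x, d x ^ 2 + s x ^ 2 / 2 = 1) /\
    (forall x, s (x + 2 * PI) = s x /\ c (x + 2 * PI) = c x /\ d (x + 2 * PI) = d x) /\
    (forall y, exists x, s x = sin y).
Proof.
  assert (HPI := PI_RGT_0).
  assert (Hpos : forall x, 1 / 2 <= 1 - sin x ^ 2 / 2 <= 1).
  { intros x. assert (H := SIN_bound x). nra. }
  (* [theta' = g theta] is the equation of the Jacobi amplitude, and [g theta] is then dn. A squared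
     modulus below 1, here 1/2, keeps [g] away from 0. *)
  set (g := fun x => sqrt (1 - sin x ^ 2 / 2)).
  assert (Hg2 : forall x, g x ^ 2 = 1 - sin x ^ 2 / 2).
  { intros x. unfold g. rewrite pow2_sqrt; [easy|]. generalize (Hpos x); lra. }
  assert (Hg : forall x, 0 < g x <= 1).
  { intros x. split.
    - apply sqrt_lt_R0. generalize (Hpos x); lra.
    - rewrite <- sqrt_1. apply sqrt_le_1_alt. generalize (Hpos x); lra. }
  assert (Hdg : forall x, is_derive g x (- sin x * cos x / 2 / g x)).
  { intros x. assert (Hgx := Hg x). unfold g in *. auto_derive.
    - generalize (Hpos x); simpl; lra.
    - replace (1 + - (sin x * (sin x * 1) * / 2)) with (1 - sin x ^ 2 / 2) by (simpl; field).
      simpl in *. field. lra. }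
  destruct (autonomous_flow g (2 * PI)) as (theta & q & Hq & Hd & Hper & Hsurj); try easy.
  - intros x. eapply is_derive_continuous, Hdg.
  - lra.
  - intros x. unfold g. now rewrite sin_plus, sin_2PI, cos_2PI, Rmult_0_r, Rmult_1_r, Rplus_0_r.
  (* Rescaling the argument by [lam] turns the period [q] into [2 * PI]. *)
  - set (lam := q / (2 * PI)).
    assert (Hl : 0 < lam) by (apply Rdiv_lt_0_compat; lra).
    assert (Hdt : forall x, is_derive (fun x => theta (lam * x)) x (lam * g (theta (lam * x)))).
    { intros x. apply (is_derive_comp theta (fun x => lam * x)); [apply Hd|].
      auto_derive; [easy|ring]. }
    assert (Hpt : forall x, theta (lam * (x + 2 * PI)) = theta (lam * x) + 2 * PI).
    { intros x. rewrite <- Hper. f_equal. unfold lam. field. lra. }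
    exists lam, (fun x => sin (theta (lam * x))), (fun x => cos (theta (lam * x))),
      (fun x => g (theta (lam * x))).
    split; [easy|].
    split; [|split; [|split; [|split; [|split; [|split]]]]].
    + intros x. replace (lam * cos (theta (lam * x)) * g (theta (lam * x)))
        with (lam * g (theta (lam * x)) * cos (theta (lam * x))) by ring.
      apply (is_derive_comp sin (fun x => theta (lam * x))); [apply is_derive_sin|easy].
    + intros x. replace (- lam * sin (theta (lam * x)) * g (theta (lam * x)))
        with (lam * g (theta (lam * x)) * (- sin (theta (lam * x)))) by ring.
      apply (is_derive_comp cos (fun x => theta (lam * x))); [apply is_derive_cos|easy].
    + intros x. assert (Hgx := Hg (theta (lam * x))).
      replace (- lam / 2 * sin (theta (lam * x)) * cos (theta (lam * x)))
        with (lam * g (theta (lam * x)) * (- sin (theta (lam * x)) * cos (theta (lam * x)) / 2 / g (theta (lam * x))))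
        by (field; lra).
      apply (is_derive_comp g (fun x => theta (lam * x))); easy.
    + intros x. generalize (sin2_cos2 (theta (lam * x))). unfold Rsqr. nra.
    + intros x. rewrite Hg2. ring.
    + intros x. unfold g. rewrite Hpt.
      now rewrite sin_plus, cos_plus, sin_2PI, cos_2PI, !Rmult_0_r, !Rmult_1_r, Rplus_0_r, Rminus_0_r.
    + intros y. destruct (Hsurj y) as [x Hx]. exists (x / lam).
      replace (lam * (x / lam)) with x by (field; lra). now rewrite Hx.
Qed.

(** * Complex-valued continuous functions *)

Lemma continuous_Rplus (f g : R -> R) (x : R) :
  continuous f x -> continuous g x -> continuous (fun y => f y + g y) x.
Proof. apply (continuous_plus (V := R_NormedModule) f g). Qed.

Lemma continuous_Rminus (f g : R -> R) (x : R) :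
  continuous f x -> continuous g x -> continuous (fun y => f y - g y) x.
Proof. apply (continuous_minus (V := R_NormedModule) f g). Qed.

Lemma continuous_Rmult (f g : R -> R) (x : R) :
  continuous f x -> continuous g x -> continuous (fun y => f y * g y) x.
Proof. apply (continuous_mult (K := R_AbsRing) f g). Qed.

Lemma RInt_Rext (f g : R -> R) (x y : R) :
  (forall z, f z = g z) -> RInt f x y = RInt g x y.
Proof. intros H. apply (RInt_ext (V := R_CompleteNormedModule)). intros z _. apply H. Qed.

Lemma RInt_Rlin (h f g : R -> R) (k l x y : R) :
  (forall z, h z = k * f z + l * g z) ->
  (forall z, continuous f z) -> (forall z, continuous g z) ->
  RInt h x y = k * RInt f x y + l * RInt g x y.
Proof.
  intros Hh Hf Hg. rewrite (RInt_Rext h _ _ _ Hh).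
  assert (If := continuous_ex_RInt f x y Hf). assert (Ig := continuous_ex_RInt g x y Hg).
  rewrite (RInt_plus (V := R_CompleteNormedModule) (fun z => k * f z) (fun z => l * g z)).
  - rewrite (RInt_scal (V := R_CompleteNormedModule) f), (RInt_scal (V := R_CompleteNormedModule) g); easy.
  - now apply (ex_RInt_scal (V := R_NormedModule)).
  - now apply (ex_RInt_scal (V := R_NormedModule)).
Qed.

(** The componentwise form hands every complex integral to the real integration lemmas by way of
    [CInt_pair]. *)
Definition Ccont (f : R -> C) : Prop :=
  forall x, continuous (fun y => Re (f y)) x /\ continuous (fun y => Im (f y)) x.

Lemma Ccont_ext (f g : R -> C) : (forall x, f x = g x) -> Ccont f -> Ccont g.
Proof.
  intros E H x. destruct (H x).
  split; [apply (continuous_ext (fun y => Re (f y)))|apply (continuous_ext (fun y => Im (f y)))];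
    try easy; intros y; now rewrite E.
Qed.

Lemma Ccont_const (z : C) : Ccont (fun _ => z).
Proof. split; apply continuous_const. Qed.

Lemma Ccont_RtoC (f : R -> R) : (forall x, continuous f x) -> Ccont (fun x => RtoC (f x)).
Proof. intros H x. split; [apply H|apply continuous_const]. Qed.

Lemma Ccont_plus (f g : R -> C) : Ccont f -> Ccont g -> Ccont (fun x => f x + g x)%C.
Proof.
  intros Hf Hg x. destruct (Hf x), (Hg x).
  split; apply (continuous_Rplus (fun y => _ (f y)) (fun y => _ (g y))); easy.
Qed.

Lemma Ccont_minus (f g : R -> C) : Ccont f -> Ccont g -> Ccont (fun x => f x - g x)%C.
Proof.
  intros Hf Hg x. destruct (Hf x), (Hg x).
  split; apply (continuous_Rminus (fun y => _ (f y)) (fun y => _ (g y))); easy.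
Qed.

Lemma Ccont_mult (f g : R -> C) : Ccont f -> Ccont g -> Ccont (fun x => f x * g x)%C.
Proof.
  intros Hf Hg x. destruct (Hf x), (Hg x).
  split.
  - apply (continuous_Rminus (fun y => Re (f y) * Re (g y)) (fun y => Im (f y) * Im (g y)));
      now apply continuous_Rmult.
  - apply (continuous_Rplus (fun y => Re (f y) * Im (g y)) (fun y => Im (f y) * Re (g y)));
      now apply continuous_Rmult.
Qed.

Lemma continuous_linear (k x : R) : continuous (fun y => k * y) x.
Proof. apply continuous_Rmult; [apply continuous_const|apply continuous_id]. Qed.

Lemma Ccont_expi (k : R) : Ccont (fun x => expi (k * x)).
Proof.
  intros x. split.
  - apply continuous_cos_comp, continuous_linear.
  - apply continuous_sin_comp, continuous_linear.
Qed.

Lemma Ccont_comp (f : R -> C) (g : R -> R) :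
  Ccont f -> (forall x, continuous g x) -> Ccont (fun x => f (g x)).
Proof.
  intros Hf Hg x. destruct (Hf (g x)).
  split; [apply (continuous_comp g (fun y => Re (f y)))|apply (continuous_comp g (fun y => Im (f y)))];
    easy.
Qed.

Lemma Ccont_Cmod_sq (f : R -> C) : Ccont f -> forall x, continuous (fun y => Cmod (f y) ^ 2) x.
Proof.
  intros Hf x. destruct (Hf x).
  apply (continuous_ext (fun y => Re (f y) * Re (f y) + Im (f y) * Im (f y))).
  - intros y. unfold Cmod. rewrite pow2_sqrt by nra. unfold Re, Im. simpl. ring.
  - apply continuous_Rplus; now apply continuous_Rmult.
Qed.

Lemma CInt_pair (f : R -> C) (x y : R) :
  Ccont f -> CInt f x y = @pair R R (RInt (fun z => Re (f z)) x y) (RInt (fun z => Im (f z)) x y).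
Proof.
  intros Hf.
  assert (H : forall g : R -> R, (forall z, continuous g z) -> is_RInt g x y (RInt g x y)).
  { intros g Hg. now apply (RInt_correct (V := R_CompleteNormedModule)), continuous_ex_RInt. }
  assert (H1 := H (fun z => Re (f z)) (fun z => proj1 (Hf z))).
  assert (H2 := H (fun z => Im (f z)) (fun z => proj2 (Hf z))).
  assert (H3 := is_RInt_fct_extend_pair (U := R_NormedModule) (V := R_NormedModule) f x y _ _ H1 H2).
  apply (is_RInt_unique (V := C_R_CompleteNormedModule)). exact H3.
Qed.

Lemma CInt_ext (f g : R -> C) (x y : R) : (forall z, f z = g z) -> CInt f x y = CInt g x y.
Proof. intros H. apply (RInt_ext (V := C_R_CompleteNormedModule)). intros z _. apply H. Qed.

Lemma CInt_RtoC (f : R -> R) (x y : R) :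
  (forall z, continuous f z) -> CInt (fun z => RtoC (f z)) x y = RtoC (RInt f x y).
Proof.
  intros Hf. rewrite CInt_pair by now apply Ccont_RtoC.
  apply injective_projections; simpl; [easy|]. rewrite RInt_const. apply Rmult_0_r.
Qed.

(* [RInt] produces equations in a type which is only convertible to [R]. *)
Ltac Rring := lazymatch goal with |- @eq _ ?a ?b => change (@eq R a b); ring end.

Lemma CInt_plus (f g : R -> C) (x y : R) :
  Ccont f -> Ccont g -> CInt (fun z => f z + g z)%C x y = (CInt f x y + CInt g x y)%C.
Proof.
  intros Hf Hg. rewrite !CInt_pair; try easy; [|now apply Ccont_plus].
  unfold Cplus; simpl.
  f_equal.
  - rewrite (RInt_Rlin _ (fun z => Re (f z)) (fun z => Re (g z)) 1 1);
      [Rring| |apply Hf|apply Hg].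
    intros; unfold Re; simpl; ring.
  - rewrite (RInt_Rlin _ (fun z => Im (f z)) (fun z => Im (g z)) 1 1);
      [Rring| |apply Hf|apply Hg].
    intros; unfold Im; simpl; ring.
Qed.

Lemma CInt_scal (f : R -> C) (k : C) (x y : R) :
  Ccont f -> CInt (fun z => k * f z)%C x y = (k * CInt f x y)%C.
Proof.
  intros Hf. rewrite !CInt_pair; try easy; [|apply Ccont_mult; [apply Ccont_const|easy]].
  unfold Cmult; simpl. fold (Re k) (Im k).
  f_equal.
  - rewrite (RInt_Rlin _ (fun z => Re (f z)) (fun z => Im (f z)) (Re k) (- Im k));
      [Rring| |apply Hf|apply Hf].
    intros; unfold Re, Im; simpl; ring.
  - rewrite (RInt_Rlin _ (fun z => Im (f z)) (fun z => Re (f z)) (Re k) (Im k));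
      [Rring| |apply Hf|apply Hf].
    intros; unfold Re, Im; simpl; ring.
Qed.

Lemma RInt_periodic_comp (f : R -> R) (p x : R) :
  (forall y, continuous f y) -> (forall y, f (y + p) = f y) ->
  RInt (fun y => f (y + x)) 0 p = RInt f 0 p.
Proof.
  intros Hf Hp. rewrite <- (RInt_periodic_shift f p Hf Hp x).
  assert (E := RInt_comp_lin (V := R_CompleteNormedModule) f 1 x 0 p
    (continuous_ex_RInt _ _ _ Hf)).
  replace (1 * 0 + x) with x in E by ring. replace (1 * p + x) with (x + p) in E by ring.
  rewrite <- E. apply RInt_Rext. intros y. change (f (y + x) = 1 * f (1 * y + x)).
  now rewrite !Rmult_1_l.
Qed.

Lemma CInt_periodic_comp (f : R -> C) (p x : R) :
  Ccont f -> (forall y, f (y + p) = f y) ->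
  CInt (fun y => f (y + x)) 0 p = CInt f 0 p.
Proof.
  intros Hf Hp. rewrite !CInt_pair; [|easy|].
  - f_equal; apply (RInt_periodic_comp (fun y => _ (f y))); try apply Hf;
      intros; now rewrite Hp.
  - apply (Ccont_comp f); [easy|].
    intros y. apply continuous_Rplus; [apply continuous_id|apply continuous_const].
Qed.

(** * Complex exponentials and their orthogonality *)

Lemma expi_plus (x y : R) : expi (x + y) = (expi x * expi y)%C.
Proof.
  unfold expi. rewrite cos_plus, sin_plus. apply injective_projections; simpl; ring.
Qed.

Lemma expi_0 : expi 0 = RtoC 1.
Proof. unfold expi. now rewrite cos_0, sin_0. Qed.

Lemma Cmod_expi (x : R) : Cmod (expi x) = 1.
Proof.
  unfold Cmod, expi. replace (_ + _) with 1; [apply sqrt_1|].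
  generalize (sin2_cos2 x). unfold Rsqr. simpl. lra.
Qed.

Lemma expi_period (x : R) (k : Z) : expi (x + IZR k * (2 * PI)) = expi x.
Proof.
  assert (H : forall y (n : nat), expi (y + INR n * (2 * PI)) = expi y).
  { intros y n. unfold expi. rewrite <- (cos_period y n), <- (sin_period y n).
    f_equal; f_equal; ring. }
  destruct (Z_le_gt_dec 0 k).
  - rewrite <- (Z2Nat.id k) by lia. rewrite <- INR_IZR_INZ. apply H.
  (* A negative shift is undone by adding the opposite number of periods. *)
  - rewrite <- (H (x + _) (Z.to_nat (- k))). f_equal.
    rewrite INR_IZR_INZ, Z2Nat.id, opp_IZR by lia. ring.
Qed.

Lemma CInt_expi (k : Z) :
  CInt (fun x => expi (IZR k * x)) 0 (2 * PI) =
  if Z.eq_dec k 0 then RtoC (2 * PI) else RtoC 0.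
Proof.
  destruct Z.eq_dec as [->|Hk].
  - rewrite (CInt_ext _ (fun _ => RtoC 1)).
    + rewrite CInt_pair by apply Ccont_const. simpl.
      rewrite !RInt_const. unfold scal; simpl; unfold mult; simpl.
      unfold RtoC; f_equal; ring.
    + intros x. now rewrite Rmult_0_l, expi_0.
  - rewrite CInt_pair by apply Ccont_expi. simpl.
    assert (Hk' : IZR k <> 0) by now apply not_0_IZR.
    assert (E := expi_period 0 k). rewrite expi_0, Rplus_0_l in E.
    unfold expi, RtoC in E. injection E as Ec Es.
    apply injective_projections; simpl.
    + rewrite (is_RInt_unique _ _ _ (sin (IZR k * (2 * PI)) / IZR k - sin (IZR k * 0) / IZR k)).
      * rewrite Es, Rmult_0_r, sin_0. cbn. field. easy.
      * apply (is_RInt_derive (V := R_CompleteNormedModule) (fun x => sin (IZR k * x) / IZR k)).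
        -- intros x _. auto_derive; [easy|cbn; field; easy].
        -- intros x _. exact (proj1 (Ccont_expi (IZR k) x)).
    + rewrite (is_RInt_unique _ _ _ (- cos (IZR k * (2 * PI)) / IZR k - - cos (IZR k * 0) / IZR k)).
      * rewrite Ec, Rmult_0_r, cos_0. cbn. field. easy.
      * apply (is_RInt_derive (V := R_CompleteNormedModule) (fun x => - cos (IZR k * x) / IZR k)).
        -- intros x _. auto_derive; [easy|cbn; field; easy].
        -- intros x _. exact (proj2 (Ccont_expi (IZR k) x)).
Qed.

(** * Trigonometric series with summable coefficients *)

(** Convertible to the finite sums in [has_sum], so that estimates on [csum] apply there
    directly. *)
Definition csum {I : Type} (L : list I) (f : I -> C) : C := fold_right Cplus (RtoC 0) (map f L).
Definition rsum {I : Type} (L : list I) (w : I -> R) : R := fold_right Rplus 0 (map w L).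

Definition Zrange (N : nat) : list Z :=
  map (fun k => Z.of_nat k - Z.of_nat N)%Z (seq 0 (2 * N + 1)).

Lemma In_Zrange (N : nat) (m : Z) : In m (Zrange N) <-> (Z.abs m <= Z.of_nat N)%Z.
Proof.
  unfold Zrange. rewrite in_map_iff. split.
  - intros [k [<- Hk]]. apply in_seq in Hk. lia.
  - intros H. exists (Z.to_nat (m + Z.of_nat N)). rewrite in_seq. lia.
Qed.

Lemma NoDup_Zrange (N : nat) : NoDup (Zrange N).
Proof.
  apply Injective_map_NoDup; [|apply seq_NoDup].
  intros x y E. lia.
Qed.

Lemma csum_app {I : Type} (L L' : list I) (f : I -> C) :
  csum (L ++ L') f = (csum L f + csum L' f)%C.
Proof.
  unfold csum. induction L as [|i L IH]; simpl.
  - now rewrite Cplus_0_l.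
  - rewrite IH. apply Cplus_assoc.
Qed.

Lemma csum_ext {I : Type} (L : list I) (f g : I -> C) :
  (forall i, In i L -> f i = g i) -> csum L f = csum L g.
Proof. intros H. unfold csum. f_equal. now apply map_ext_in. Qed.

Lemma csum_zero {I : Type} (L : list I) (f : I -> C) :
  (forall i, In i L -> f i = RtoC 0) -> csum L f = RtoC 0.
Proof.
  unfold csum. induction L as [|i L IH]; simpl; intros H; [easy|].
  rewrite H, IH by auto. apply Cplus_0_l.
Qed.

Lemma csum_single (L : list Z) (f : Z -> C) (m : Z) :
  NoDup L -> In m L -> (forall j, j <> m -> f j = RtoC 0) -> csum L f = f m.
Proof.
  intros HL Hm Hf. induction HL as [|i L Hi HL IH]; [easy|].
  unfold csum in *. simpl. destruct Hm as [->|Hm].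
  - change (f m + csum L f = f m)%C. rewrite csum_zero; [apply Cplus_0_r|].
    intros j Hj. apply Hf. now intros ->.
  - rewrite IH, Hf by (try easy; now intros ->). apply Cplus_0_l.
Qed.

Lemma csum_scal {I : Type} (L : list I) (f : I -> C) (k : C) :
  csum L (fun i => k * f i)%C = (k * csum L f)%C.
Proof.
  unfold csum. induction L as [|i L IH]; simpl; [ring|]. rewrite IH. ring.
Qed.

Lemma Cmod_csum_le {I : Type} (L : list I) (f : I -> C) (w : I -> R) :
  (forall i, In i L -> Cmod (f i) <= w i) -> Cmod (csum L f) <= rsum L w.
Proof.
  unfold csum, rsum. induction L as [|i L IH]; simpl; intros H.
  - rewrite Cmod_0. lra.
  - eapply Rle_trans; [apply Cmod_triangle|]. apply Rplus_le_compat; auto.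
Qed.

(** Without duplicates, filtering out [m] removes at most one term. The inequality form covers the
    case where [m] is absent. *)
Lemma rsum_filter_neq (L : list Z) (w : Z -> R) (m : Z) :
  (forall j, 0 <= w j) -> NoDup L ->
  rsum L w <= w m + rsum (filter (fun j => negb (Z.eqb j m)) L) w.
Proof.
  intros Hw HL. unfold rsum. induction HL as [|i L Hi HL IH]; simpl.
  - generalize (Hw m); lra.
  - destruct (Z.eqb_spec i m) as [->|Hne]; simpl.
    + rewrite forallb_filter_id; [lra|].
      apply forallb_forall. intros j Hj. destruct (Z.eqb_spec j m) as [->|]; easy.
    + lra.
Qed.

(** Raising [M] by one admits only the two frequencies of modulus [P + 1], where [P = N + M]. Each
    contributes at most [/ P - / (P + 1)], so the bound telescopes, with factor 2 for the two
    signs. *)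
Lemma rsum_inv_sq_bounded (N M : nat) :
  (1 <= N)%nat -> forall L : list Z, NoDup L ->
  (forall m, In m L -> (Z.of_nat N < Z.abs m <= Z.of_nat (N + M))%Z) ->
  rsum L (fun m => / IZR m ^ 2) <= 2 / INR N - 2 / INR (N + M).
Proof.
  intros HN.
  (* At [j = 0] the convention [/ 0 = 0] makes the weight vanish. *)
  assert (Hw : forall j, 0 <= / IZR j ^ 2).
  { intros j. destruct (Req_dec (IZR j) 0) as [E|E].
    - rewrite E. simpl. rewrite Rmult_0_l, Rinv_0. lra.
    - apply Rlt_le, Rinv_0_lt_compat. nra. }
  induction M as [|M IH]; intros L HL Hm.
  - destruct L as [|m L].
    + unfold rsum; simpl. rewrite Nat.add_0_r. lra.
    + assert (H := Hm m (or_introl eq_refl)). lia.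
  - set (k := Z.of_nat (N + S M)).
    assert (H1 := rsum_filter_neq L (fun m => / IZR m ^ 2) k Hw HL).
    assert (HL1 := NoDup_filter (fun j => negb (Z.eqb j k)) HL).
    assert (H2 := rsum_filter_neq _ (fun m => / IZR m ^ 2) (- k) Hw HL1).
    assert (HL2 := NoDup_filter (fun j => negb (Z.eqb j (- k))) HL1).
    specialize (IH _ HL2).
    assert (IH' : rsum (filter (fun j => negb (Z.eqb j (- k))) (filter (fun j => negb (Z.eqb j k)) L))
              (fun m => / IZR m ^ 2) <= 2 / INR N - 2 / INR (N + M)).
    { apply IH. intros m Hin. apply filter_In in Hin as [Hin E2].
      apply filter_In in Hin as [Hin E1]. apply Hm in Hin.
      destruct (Z.eqb_spec m k), (Z.eqb_spec m (- k)); try easy. unfold k in *. lia. }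
    assert (Ek : IZR k = INR (N + M) + 1).
    { unfold k. rewrite <- INR_IZR_INZ, <- S_INR. f_equal. lia. }
    cbv beta in H1, H2. rewrite opp_IZR, Ek in H2. rewrite Ek in H1.
    replace (N + S M)%nat with (S (N + M)) by lia. rewrite S_INR.
    assert (HP : 1 <= INR (N + M)) by (change 1 with (INR 1); apply le_INR; lia).
    set (P := INR (N + M)) in *.
    assert (/ (P + 1) ^ 2 <= / P - / (P + 1)).
    { replace (/ P - / (P + 1)) with (/ (P * (P + 1))) by (field; lra).
      apply Rinv_le_contravar; nra. }
    replace ((- (P + 1)) ^ 2) with ((P + 1) ^ 2) in H2 by ring.
    unfold Rdiv in *. lra.
Qed.

Lemma rsum_inv_sq_tail (N : nat) (L : list Z) :
  (1 <= N)%nat -> NoDup L -> (forall m, In m L -> (Z.of_nat N < Z.abs m)%Z) ->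
  rsum L (fun m => / IZR m ^ 2) <= 2 / INR N.
Proof.
  intros HN HL Hm.
  assert (HM : exists M : nat, forall m, In m L -> (Z.abs m <= Z.of_nat M)%Z).
  { clear. induction L as [|i L [M IH]].
    - now exists O.
    - exists (M + Z.abs_nat i)%nat. intros m [<-|H]; [|apply IH in H]; lia. }
  destruct HM as [M HM].
  assert (H := rsum_inv_sq_bounded N M HN L HL).
  assert (0 < 2 / INR (N + M)).
  { apply Rdiv_lt_0_compat; [lra|]. apply lt_0_INR. lia. }
  assert (rsum L (fun m => / IZR m ^ 2) <= 2 / INR N - 2 / INR (N + M)); [|lra].
  apply H. intros m Hin. generalize (Hm m Hin) (HM m Hin). lia.
Qed.

(** Frequency 0 is left out because [/ 0 = 0] would force [g 0] to vanish. *)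
Definition inverse_square_decay (K : R) (g : Z -> C) : Prop :=
  forall m, m <> 0%Z -> Cmod (g m) <= K * / IZR m ^ 2.

Lemma has_sum_Zrange (K : R) (f : Z -> C) (l : C) (N : nat) :
  0 <= K -> inverse_square_decay K f -> has_sum (fun _ => True) f l ->
  (1 <= N)%nat -> Cmod (l - csum (Zrange N) f) <= 2 * K / INR N.
Proof.
  intros HK Hf Hl HN. apply le_epsilon. intros eps Heps.
  destruct (Hl eps Heps) as [L0 [_ HL0]].
  (* Adding to [Zrange N] the frequencies of [L0] beyond [N] gives a list that contains [L0], so its
     sum is within [eps] of [l]. The added part is bounded by the tail estimate. *)
  set (L' := filter (fun m => Z.ltb (Z.of_nat N) (Z.abs m)) (nodup Z.eq_dec L0)).
  assert (HL' : NoDup L') by apply NoDup_filter, NoDup_nodup.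
  assert (HinL' : forall m, In m L' -> (Z.of_nat N < Z.abs m)%Z).
  { intros m Hm. apply filter_In in Hm as [_ Hm]. now apply Z.ltb_lt. }
  assert (H : Cmod (csum (Zrange N ++ L') f - l) < eps).
  { apply HL0; [|easy|].
    - apply NoDup_app; [apply NoDup_Zrange|easy|].
      intros m Hm Hm'. apply In_Zrange in Hm. apply HinL' in Hm'. lia.
    - intros m Hm. apply in_or_app.
      destruct (Z_lt_le_dec (Z.of_nat N) (Z.abs m)).
      + right. apply filter_In. split; [now apply nodup_In|now apply Z.ltb_lt].
      + left. now apply In_Zrange. }
  assert (H' : Cmod (csum L' f) <= 2 * K / INR N).
  { apply Rle_trans with (rsum L' (fun m => K * / IZR m ^ 2)).
    - apply Cmod_csum_le. intros m Hm. apply Hf. apply HinL' in Hm. lia.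
    - replace (rsum L' (fun m => K * / IZR m ^ 2)) with (K * rsum L' (fun m => / IZR m ^ 2)).
      + replace (2 * K / INR N) with (K * (2 / INR N)) by (unfold Rdiv; ring).
        apply Rmult_le_compat_l; [easy|]. now apply rsum_inv_sq_tail.
      + unfold rsum. clear. induction L' as [|i L IH]; cbn [fold_right map]; [ring|].
        rewrite <- IH. ring. }
  rewrite csum_app in H.
  replace (l - csum (Zrange N) f)%C
    with (csum L' f + - (csum (Zrange N) f + csum L' f - l))%C by ring.
  eapply Rle_trans; [apply Cmod_triangle|]. rewrite Cmod_opp. lra.
Qed.

(** The threshold [N0] allows for a frequency [m] that belongs to the partial sum only once
    [N >= |m|]. *)
Lemma le_const_div_n (x K : R) (N0 : nat) :
  (forall N, (1 <= N)%nat -> (N0 <= N)%nat -> x <= K / INR N) -> x <= 0.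
Proof.
  intros H. apply Rnot_lt_le. intros Hx.
  destruct (INR_unbounded (K / x)) as [N HN].
  set (M := S (N + N0)).
  assert (HM : INR N <= INR M) by (apply le_INR; unfold M; lia).
  assert (HM0 : 0 < INR M) by (apply lt_0_INR; unfold M; lia).
  assert (x <= K / INR M) by (apply H; unfold M; lia).
  assert (x * INR M <= K).
  { replace K with (K / INR M * INR M) by (field; lra). apply Rmult_le_compat_r; lra. }
  assert (K < INR M * x).
  { replace K with (K / x * x) by (field; lra). apply Rmult_lt_compat_r; lra. }
  lra.
Qed.

Lemma continuous_uniform_limit (h : R -> R) (S : nat -> R -> R) (K : R) :
  (forall N x, continuous (S N) x) ->
  (forall N x, (1 <= N)%nat -> Rabs (h x - S N x) <= K / INR N) ->
  forall x, continuous h x.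
Proof.
  intros HS Hh x. apply filterlim_locally. intros [eps Heps].
  destruct (INR_unbounded (4 * K / eps)) as [N HN].
  set (M := Datatypes.S N).
  assert (HM : INR M = INR N + 1) by (unfold M; now rewrite S_INR).
  assert (HM0 : 0 < INR M) by (apply lt_0_INR; unfold M; lia).
  assert (HK : K / INR M < eps / 4).
  { apply Rmult_lt_reg_r with (INR M); [easy|].
    replace (K / INR M * INR M) with K by (field; lra).
    assert (4 * K < INR M * eps); [|lra].
    replace (4 * K) with (4 * K / eps * eps) by (field; lra). apply Rmult_lt_compat_r; lra. }
  assert (He2 : 0 < eps / 4) by lra.
  generalize (proj1 (filterlim_locally (S M) (S M x)) (HS M x) (mkposreal _ He2)).
  apply filter_imp. intros y Hy.
  change (Rabs (S M y - S M x) < eps / 4) in Hy.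
  change (Rabs (h y - h x) < eps).
  assert (H1 := Hh M x ltac:(unfold M; lia)). assert (H2 := Hh M y ltac:(unfold M; lia)).
  revert Hy H1 H2. unfold Rabs; repeat destruct Rcase_abs; lra.
Qed.

Lemma Re_le_Cmod (z : C) : Rabs (Re z) <= Cmod z.
Proof. eapply Rle_trans; [apply Rmax_l|apply Rmax_Cmod]. Qed.
Lemma Im_le_Cmod (z : C) : Rabs (Im z) <= Cmod z.
Proof. eapply Rle_trans; [apply Rmax_r|apply Rmax_Cmod]. Qed.

Lemma Ccont_uniform_limit (h : R -> C) (S : nat -> R -> C) (K : R) :
  (forall N, Ccont (S N)) ->
  (forall N x, (1 <= N)%nat -> Cmod (h x - S N x) <= K / INR N) -> Ccont h.
Proof.
  intros HS Hh x. split.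
  - apply (continuous_uniform_limit (fun y => Re (h y)) (fun N y => Re (S N y)) K).
    + intros N y. exact (proj1 (HS N y)).
    + intros N y HN. apply Rle_trans with (2 := Hh N y HN).
      apply (Re_le_Cmod (h y - S N y)).
  - apply (continuous_uniform_limit (fun y => Im (h y)) (fun N y => Im (S N y)) K).
    + intros N y. exact (proj2 (HS N y)).
    + intros N y HN. apply Rle_trans with (2 := Hh N y HN).
      apply (Im_le_Cmod (h y - S N y)).
Qed.

Lemma Cmod_le_Rabs (x y : R) : Cmod (x, y) <= Rabs x + Rabs y.
Proof.
  replace (x, y) with (RtoC x + Ci * RtoC y)%C
    by (apply injective_projections; simpl; ring).
  eapply Rle_trans; [apply Cmod_triangle|].
  rewrite Cmod_mult, !Cmod_R.
  replace (Cmod Ci) with 1; [lra|].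
  unfold Cmod, Ci; simpl. rewrite <- sqrt_1 at 1. f_equal. ring.
Qed.

(** The factor 2 comes from estimating real and imaginary parts separately; sharp constants do not
    matter for the limits taken later. *)
Lemma CInt_bound (f : R -> C) (x y M : R) :
  Ccont f -> x <= y -> (forall z, Cmod (f z) <= M) -> Cmod (CInt f x y) <= 2 * ((y - x) * M).
Proof.
  intros Hf Hxy HM. rewrite CInt_pair by easy.
  set (r := RInt (fun z => Re (f z)) x y). set (i := RInt (fun z => Im (f z)) x y).
  assert (Hr : Rabs r <= (y - x) * M).
  { apply (abs_RInt_le_const (fun z => Re (f z))); [easy| |].
    - apply continuous_ex_RInt, Hf.
    - intros z _. apply Rle_trans with (2 := HM z), Re_le_Cmod. }
  assert (Hi : Rabs i <= (y - x) * M).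
  { apply (abs_RInt_le_const (fun z => Im (f z))); [easy| |].
    - apply continuous_ex_RInt, Hf.
    - intros z _. apply Rle_trans with (2 := HM z), Im_le_Cmod. }
  assert (H := Cmod_le_Rabs r i). lra.
Qed.

Lemma Ccont_csum (L : list Z) (f : Z -> R -> C) :
  (forall j, Ccont (f j)) -> Ccont (fun x => csum L (fun j => f j x)).
Proof.
  intros Hf. unfold csum. induction L as [|j L IH]; simpl.
  - apply Ccont_const.
  - now apply Ccont_plus.
Qed.

Lemma CInt_csum (L : list Z) (f : Z -> R -> C) (x y : R) :
  (forall j, Ccont (f j)) ->
  CInt (fun z => csum L (fun j => f j z)) x y = csum L (fun j => CInt (f j) x y).
Proof.
  intros Hf. unfold csum. induction L as [|j L IH]; simpl.
  - rewrite CInt_pair by apply Ccont_const. simpl. rewrite !RInt_const.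
    apply injective_projections; simpl; apply Rmult_0_r.
  - rewrite CInt_plus; [now rewrite IH|easy|now apply Ccont_csum].
Qed.

Lemma fourier_trigonometric_polynomial (L : list Z) (g : Z -> C) (m : Z) :
  NoDup L -> In m L ->
  fourier (fun x => csum L (fun j => expi (IZR j * x) * g j)%C) m = g m.
Proof.
  intros HL Hm. unfold fourier.
  rewrite (CInt_ext _ (fun x => csum L (fun j => g j * expi (IZR (j - m) * x))%C)).
  - rewrite CInt_csum by (intros; apply Ccont_mult; [apply Ccont_const|apply Ccont_expi]).
    rewrite (csum_single _ _ m HL Hm).
    + rewrite CInt_scal, CInt_expi by apply Ccont_expi.
      destruct Z.eq_dec; [|lia]. generalize PI_RGT_0. intros.
      apply injective_projections; simpl; field; lra.
    + intros j Hj. rewrite CInt_scal, CInt_expi by apply Ccont_expi.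
      destruct Z.eq_dec; [lia|]. apply Cmult_0_r.
  - intros x. rewrite <- csum_scal. apply csum_ext. intros j _.
    rewrite minus_IZR.
    replace ((IZR j - IZR m) * x) with (- (IZR m * x) + IZR j * x) by ring.
    rewrite expi_plus. ring.
Qed.

Lemma Ccont_mode (m : Z) (u : R -> C) :
  Ccont u -> Ccont (fun x => expi (- (IZR m * x)) * u x)%C.
Proof.
  intros Hu. apply Ccont_mult; [|easy].
  apply (Ccont_ext (fun x => expi (- IZR m * x))); [|apply Ccont_expi].
  intros x. f_equal. ring.
Qed.

Lemma fourier_lin (u w : R -> C) (k : C) (m : Z) :
  Ccont u -> Ccont w -> fourier (fun x => u x + k * w x)%C m = (fourier u m + k * fourier w m)%C.
Proof.
  intros Hu Hw. unfold fourier.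
  rewrite (CInt_ext _ (fun x => expi (- (IZR m * x)) * u x + k * (expi (- (IZR m * x)) * w x))%C).
  - rewrite CInt_plus; [|now apply Ccont_mode|].
    + rewrite CInt_scal by now apply Ccont_mode. ring.
    + apply Ccont_mult; [apply Ccont_const|now apply Ccont_mode].
  - intros x. ring.
Qed.

Lemma fourier_ext (u w : R -> C) (m : Z) : (forall x, u x = w x) -> fourier u m = fourier w m.
Proof. intros H. unfold fourier. f_equal. apply CInt_ext. intros x. now rewrite H. Qed.

Lemma fourier_minus (u w : R -> C) (m : Z) :
  Ccont u -> Ccont w -> fourier (fun x => u x - w x)%C m = (fourier u m - fourier w m)%C.
Proof.
  intros Hu Hw. rewrite (fourier_ext _ (fun x => u x + - RtoC 1 * w x)%C) by (intros; ring).
  rewrite fourier_lin by easy. ring.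
Qed.

Lemma fourier_bound (u : R -> C) (m : Z) (M : R) :
  Ccont u -> (forall x, Cmod (u x) <= M) -> Cmod (fourier u m) <= 2 * M.
Proof.
  intros Hu HM. unfold fourier. assert (HPI := PI_RGT_0).
  rewrite Cmod_mult, Cmod_R, Rabs_pos_eq by (apply Rlt_le, Rinv_0_lt_compat; lra).
  apply Rmult_le_reg_l with (2 * PI); [lra|].
  rewrite <- Rmult_assoc, Rinv_r, Rmult_1_l by lra.
  eapply Rle_trans; [apply CInt_bound with (M := M)|].
  - now apply Ccont_mode.
  - lra.
  - intros x. rewrite Cmod_mult, Cmod_expi, Rmult_1_l. apply HM.
  - lra.
Qed.

(** The flow relations describe their output by a series at each point; this recovers its continuity
    and its coefficients. Symmetric partial sums converge uniformly at rate [2 * K / N], and their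
    [m]-th coefficient is exactly [g m] once [N >= |m|]. *)
Lemma trigonometric_series (K : R) (g : Z -> C) (h : R -> C) :
  0 <= K -> inverse_square_decay K g ->
  (forall x, has_sum (fun _ => True) (fun m => expi (IZR m * x) * g m)%C (h x)) ->
  Ccont h /\ forall m, fourier h m = g m.
Proof.
  intros HK Hg Hh.
  set (s := fun N x => csum (Zrange N) (fun j => expi (IZR j * x) * g j)%C).
  assert (Hs : forall N, Ccont (s N)).
  { intros N. apply Ccont_csum. intros j.
    apply Ccont_mult; [apply Ccont_expi|apply Ccont_const]. }
  assert (Hd : forall N x, (1 <= N)%nat -> Cmod (h x - s N x) <= 2 * K / INR N).
  { intros N x HN. apply has_sum_Zrange; [easy| |easy|easy].
    intros m Hm. rewrite Cmod_mult, Cmod_expi, Rmult_1_l. now apply Hg. }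
  assert (Hc := Ccont_uniform_limit h s _ Hs Hd).
  split; [easy|]. intros m.
  assert (E : Cmod (fourier h m - g m) <= 0).
  { apply le_const_div_n with (2 * (2 * K)) (Z.abs_nat m). intros N HN HNm.
    rewrite <- (fourier_trigonometric_polynomial (Zrange N) g m) at 1;
      [|apply NoDup_Zrange|apply In_Zrange; lia].
    fold (s N). rewrite <- (fourier_minus h (s N)) by easy.
    unfold Rdiv. rewrite Rmult_assoc.
    apply fourier_bound; [now apply Ccont_minus|]. intros x. now apply Hd. }
  assert (E' : (fourier h m - g m)%C = RtoC 0).
  { apply Cmod_eq_0, Rle_antisym; [easy|apply Cmod_ge_0]. }
  replace (fourier h m) with (fourier h m - g m + g m)%C by ring.
  rewrite E'. apply Cplus_0_l.
Qed.

(** * Derivatives of complex-valued functions and smoothness up to the end times *)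

Lemma is_derive_C (f g : R -> R) (x l m : R) :
  is_derive f x l -> is_derive g x m ->
  @is_derive R_AbsRing C_R_NormedModule (fun y => (f y, g y)) x (l, m).
Proof.
  intros Hf Hg.
  assert (H1 := is_derive_scal_l (V := C_R_NormedModule) f x l (RtoC 1) Hf).
  assert (H2 := is_derive_scal_l (V := C_R_NormedModule) g x m Ci Hg).
  assert (H := is_derive_plus (V := C_R_NormedModule) _ _ _ _ _ H1 H2).
  replace (l, m) with (@plus C_R_NormedModule (@scal R_AbsRing C_R_NormedModule l (RtoC 1))
    (@scal R_AbsRing C_R_NormedModule m Ci)).
  - refine (is_derive_ext (V := C_R_NormedModule) _ _ _ _ _ H).
    intros y. apply injective_projections; cbn; unfold mult; cbn; ring.
  - apply injective_projections; cbn; unfold mult; cbn; ring.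
Qed.

(** [filterdiff] speaks about every limit [y] of the filter. Since [P t] holds, the restricted
    filter is proper, so [t] is its only limit and the unrestricted estimate at [t] can be
    restricted. *)
Lemma is_derive_filterdiff_within (f : R -> C) (l : C) (P : R -> Prop) (t : R) :
  P t -> @is_derive R_AbsRing C_R_NormedModule f t l ->
  @filterdiff R_AbsRing R_NormedModule C_R_NormedModule f (within P (locally t))
    (fun h => @scal R_AbsRing C_R_NormedModule h l).
Proof.
  intros Ht [Hlin Hdom]. split; [exact Hlin|].
  intros y Hy.
  assert (HP : ProperFilter' (within P (locally t))).
  { split.
    - intros H. unfold within in H. now apply (locally_singleton _ _ H).
    - apply within_filter, locally_filter. }
  assert (E : t = y).
  { apply (is_filter_lim_unique (F := within P (locally t))
      (K := R_AbsRing) (V := R_NormedModule)); [|exact Hy].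
    intros Q HQ. apply filter_le_within. exact HQ. }
  subst y. intros eps.
  apply filter_le_within. exact (Hdom t (fun Q HQ => HQ) eps).
Qed.

(** The test solutions exist for all real times, so the one-sided conditions at the end times follow
    from two-sided ones. *)
Lemma smooth_with_derivatives_intro (T : R) (u : R -> R -> C) (D : nat -> nat -> R -> R -> C) :
  (forall t x, D 0%nat 0%nat t x = u t x) ->
  (forall j k t x,
     @is_derive R_AbsRing C_R_NormedModule (fun s => D j k s x) t (D (j + 1)%nat k t x) /\
     @is_derive R_AbsRing C_R_NormedModule (fun y => D j k t y) x (D j (k + 1)%nat t x) /\
     @continuous (prod_UniformSpace R_UniformSpace R_UniformSpace) C_UniformSpace
       (fun z => D j k (fst z) (snd z)) (t, x)) ->
  smooth_with_derivatives T u D.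
Proof.
  intros H0 H. split; [now intros; apply H0|].
  intros j k t x Ht. destruct (H j k t x) as (H1 & H2 & H3).
  split; [|split; [exact H2|]].
  - now apply is_derive_filterdiff_within.
  - intros P HP. apply filter_le_within. now apply H3.
Qed.

(** * Reduction to the linear flow *)

Lemma explicit_scheme_diagonal (S : nat) (a : stage -> stage -> R) (i : stage) :
  explicit_scheme S a -> is_stage S i -> a i i = 0.
Proof.
  intros [order [_ [Hin Hlow]]] Hi.
  apply Hin, In_nth_error in Hi. destruct Hi as [n Hn].
  now apply (Hlow n n).
Qed.

Lemma RK_step_zero_weights E F (S : nat) (c : nat -> R) (b : stage -> R)
    (a : stage -> stage -> R) (tau : R) (u0 u1 : R -> C) :
  (forall i, is_stage S i -> b i = 0) -> RK_step E F S c b a tau u0 u1 -> E tau u0 u1.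
Proof.
  intros Hb (K & EK & Eu0 & _ & HE & _ & Hu1).
  replace u1 with Eu0; [easy|].
  apply functional_extensionality. intros x. rewrite Hu1.
  assert (Hs : stage_sum S (fun i => RtoC (b i) * EK i x)%C = RtoC 0).
  { assert (H0 : forall f : nat -> C, (forall n, (n <= S)%nat -> f n = RtoC 0) ->
      @sum_n C_AbelianMonoid f S = RtoC 0).
    { intros f Hf. rewrite (sum_n_ext_loc (G := C_AbelianMonoid) f (fun _ => RtoC 0)) by easy.
      apply (sum_n_m_const_zero (G := C_AbelianMonoid)). }
    unfold stage_sum. apply H0. intros p Hp. apply H0. intros q Hq. apply H0. intros r Hr.
    rewrite Hb by easy. apply Cmult_0_l. }
  rewrite Hs. ring.
Qed.

(** The reduction is uniform in [E] and [F], so it serves both equations. *)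
Lemma explicit_symplectic_consistent_linear (solution : R -> (R -> R -> C) -> Prop)
    E F (S : nat) (c : nat -> R) (b : stage -> R) (a : stage -> stage -> R) :
  (forall p q r p' q' r' : nat,
     is_stage S (p, q, r) -> is_stage S (p', q', r') ->
     b (p', q', r') * b (p, q, r) =
       b (p, q, r) * a (p, q, r) (p', q', r') +
       b (p', q', r') * a (p', q', r') (p, q, r)) ->
  explicit_scheme S a -> consistent solution (RK_step E F S c b a) ->
  consistent solution E.
Proof.
  intros Hsymp Hexp Hcons.
  assert (Hb : forall i, is_stage S i -> b i = 0).
  { intros [[p q] r] Hi. assert (H := Hsymp p q r p q r Hi Hi).
    rewrite (explicit_scheme_diagonal S a (p, q, r) Hexp Hi) in H. nra. }
  intros T u HT Hu. destruct (Hcons T u HT Hu) as [u1 [Hstep Hlim]].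
  exists u1. split; [|exact Hlim].
  revert Hstep. apply filter_imp. intros tau. now apply RK_step_zero_weights.
Qed.

(** Turns an error of order o(tau) into an equation: [f] is a scalar quantity dominated by the error
    [N], and its slope at 0 cannot exceed the limit of [N tau / tau]. With tolerance [|l| / 2] for
    both limits, a nonzero [l] would satisfy [|l| < |l|]. *)
Lemma is_derive_bounded_by_little_o (f N : R -> R) (l : R) :
  is_derive f 0 l -> f 0 = 0 ->
  at_right 0 (fun tau => Rabs (f tau) <= N tau) ->
  filterlim (fun tau => N tau / tau) (at_right 0) (locally 0) -> l = 0.
Proof.
  intros Hf Hf0 Hle HN. apply is_derive_Reals in Hf.
  destruct (Req_dec l 0) as [|Hl]; [easy|exfalso].
  assert (Heps : 0 < Rabs l / 2) by (assert (H := Rabs_pos_lt l Hl); lra).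
  destruct (Hf _ Heps) as [delta Hdelta].
  assert (H1 := proj1 (filterlim_locally _ _) HN (mkposreal _ Heps)).
  assert (H2 : at_right 0 (fun tau => 0 < tau < delta)).
  { exists delta. intros y Hy Hpos. change (Rabs (y - 0) < delta) in Hy.
    rewrite Rminus_0_r in Hy. generalize (Rle_abs y). lra. }
  destruct (filter_ex (F := at_right 0) _ (filter_and _ _ Hle (filter_and _ _ H1 H2)))
    as [tau [Htau [HNt [Hpos Hd]]]].
  change (Rabs (N tau / tau - 0) < Rabs l / 2) in HNt.
  assert (Hft := Hdelta tau ltac:(lra) ltac:(rewrite Rabs_pos_eq; lra)).
  rewrite Rplus_0_l, Hf0, !Rminus_0_r in *.
  assert (HNt' : N tau / tau < Rabs l / 2) by (generalize (Rle_abs (N tau / tau)); lra).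
  assert (Hq : Rabs (f tau / tau) <= N tau / tau).
  { unfold Rdiv. rewrite Rabs_mult, (Rabs_pos_eq (/ tau)).
    - apply Rmult_le_compat_r; [|easy]. now apply Rlt_le, Rinv_0_lt_compat.
    - now apply Rlt_le, Rinv_0_lt_compat. }
  assert (Rabs l <= Rabs (l - f tau / tau) + Rabs (f tau / tau)).
  { eapply Rle_trans; [|apply Rabs_triang]. right. f_equal. ring. }
  rewrite Rabs_minus_sym in Hft. lra.
Qed.

(** * The cubic nonlinear Schrödinger equation *)

(** Terms outside [L] add nothing, so the finite sums are constant from [L] onwards. *)
Lemma has_sum_csum_eq (L : list Z) (f : Z -> C) (l : C) :
  NoDup L -> (forall m, ~ In m L -> f m = RtoC 0) ->
  has_sum (fun _ => True) f l -> l = csum L f.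
Proof.
  intros HL Hf Hl.
  assert (E : Cmod (csum L f - l) <= 0).
  { apply le_epsilon. intros eps Heps. destruct (Hl eps Heps) as [L0 [_ H]].
    set (L' := filter (fun m => if in_dec Z.eq_dec m L then false else true) (nodup Z.eq_dec L0)).
    assert (HL' : forall m, In m L' <-> In m L0 /\ ~ In m L).
    { intros m. unfold L'. rewrite filter_In, nodup_In. destruct in_dec; easy. }
    assert (Hlt : Cmod (csum (L ++ L') f - l) < eps).
    { apply H; [|easy|].
      - apply NoDup_app; [easy|apply NoDup_filter, NoDup_nodup|].
        intros m Hm Hm'. now apply HL' in Hm'.
      - intros m Hm. apply in_or_app. rewrite HL'.
        destruct (in_dec Z.eq_dec m L); auto. }
    rewrite csum_app, (csum_zero L') in Hlt by (intros m Hm; apply Hf; now apply HL').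
    rewrite Cplus_0_r in Hlt. lra. }
  assert (E' : (csum L f - l)%C = RtoC 0).
  { apply Cmod_eq_0, Rle_antisym; [easy|apply Cmod_ge_0]. }
  replace l with (csum L f - (csum L f - l))%C by ring. rewrite E'. ring.
Qed.

Lemma L2norm_const (z : C) : L2norm (fun _ => z) = sqrt (2 * PI) * Cmod z.
Proof.
  unfold L2norm. rewrite RInt_const. unfold scal; simpl; unfold mult; simpl.
  rewrite Rminus_0_r, sqrt_mult_alt by (generalize PI_RGT_0; lra).
  rewrite Rmult_1_r, sqrt_square; [easy|apply Cmod_ge_0].
Qed.

Lemma fourier_1 (m : Z) : fourier (fun _ => RtoC 1) m = if Z.eq_dec m 0 then RtoC 1 else RtoC 0.
Proof.
  unfold fourier. rewrite (CInt_ext _ (fun x => expi (IZR (- m) * x))).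
  - rewrite CInt_expi. destruct (Z.eq_dec (- m) 0), (Z.eq_dec m 0); try lia.
    + generalize PI_RGT_0. intros. apply injective_projections; simpl; field; lra.
    + apply Cmult_0_r.
  - intros x. rewrite opp_IZR, Cmult_1_r. f_equal. ring.
Qed.

Lemma NLSE_plane_wave (mu T : R) : NLSE_smooth_solution mu T (fun t _ => expi (- (mu * t))).
Proof.
  (* [z = - i mu]: each time derivative multiplies the wave by [z]. *)
  set (z := (0, - mu) : C). set (w := pow_n (K := C_Ring) z).
  assert (Hw : forall j, w (j + 1)%nat = (z * w j)%C).
  { intros j. now rewrite Nat.add_1_r. }
  assert (Hd : forall j t, @is_derive R_AbsRing C_R_NormedModule
    (fun s => w j * expi (- (mu * s)))%C t (w (j + 1)%nat * expi (- (mu * t)))%C).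
  { intros j t. rewrite Hw.
    refine (is_derive_C (fun s => fst (w j) * cos (- (mu * s)) - snd (w j) * sin (- (mu * s)))
      (fun s => fst (w j) * sin (- (mu * s)) + snd (w j) * cos (- (mu * s))) t _ _ _ _);
      auto_derive; try easy; simpl; ring. }
  split; [now intros|].
  exists (fun j k t x => if Nat.eq_dec k 0 then (w j * expi (- (mu * t)))%C else RtoC 0).
  split.
  - apply smooth_with_derivatives_intro.
    + intros t x. simpl. apply Cmult_1_l.
    + intros j k t x. destruct (Nat.eq_dec (k + 1) 0); [lia|].
      destruct (Nat.eq_dec k 0); (split; [|split]); simpl.
      * apply Hd.
      * apply (is_derive_const (V := C_R_NormedModule)).
      * apply (continuous_comp (U := prod_UniformSpace R_UniformSpace R_UniformSpace)
          fst (fun t => w j * expi (- (mu * t)))%C); [apply continuous_fst|].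
        apply (ex_derive_continuous (V := C_R_NormedModule)). eexists. apply Hd.
      * apply (is_derive_const (V := C_R_NormedModule)).
      * apply (is_derive_const (V := C_R_NormedModule)).
      * apply continuous_const.
  - intros t x _. simpl. rewrite Cmod_expi.
    change (w 1%nat) with (z * w 0%nat)%C. change (w 0%nat) with (RtoC 1).
    apply injective_projections; simpl; ring.
Qed.

Lemma NLSE_flow_not_consistent (mu : R) :
  mu <> 0 -> ~ consistent (NLSE_smooth_solution mu) NLSE_flow.
Proof.
  intros Hmu Hcons. apply Hmu.
  destruct (Hcons 1 _ Rlt_0_1 (NLSE_plane_wave mu 1)) as [u1 [Hflow Hlim]].
  assert (Hs : 0 < sqrt (2 * PI)) by (apply sqrt_lt_R0; generalize PI_RGT_0; lra).
  assert (Hl : sqrt (2 * PI) * mu = 0); [|nra].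
  (* The error is the constant [exp (- i mu tau) - 1], whose modulus is at least that of its
     imaginary part; [sqrt (2 * PI)] is the L2 norm of 1. *)
  refine (is_derive_bounded_by_little_o (fun tau => sqrt (2 * PI) * sin (mu * tau)) _ _ _ _ _ Hlim).
  - auto_derive; [easy|]. rewrite Rmult_0_r, cos_0. ring.
  - rewrite Rmult_0_r, sin_0. apply Rmult_0_r.
  - revert Hflow. apply filter_imp. intros tau H.
    assert (Hu1 : u1 tau = fun _ => RtoC 1).
    { apply functional_extensionality. intros x. specialize (H x).
      replace (fun _ : R => expi (- (mu * 0))) with (fun _ : R => RtoC 1) in H
        by (now rewrite Rmult_0_r, Ropp_0, expi_0).
      rewrite (fun Hf => has_sum_csum_eq (0%Z :: nil) _ _
        (NoDup_cons 0%Z (in_nil (a := 0%Z)) (NoDup_nil Z)) Hf H).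
      - unfold csum. simpl. rewrite fourier_1. simpl.
        rewrite !Rmult_0_l, Rmult_0_r, Ropp_0, expi_0. ring.
      - intros m Hm. rewrite fourier_1. destruct Z.eq_dec as [->|].
        + exfalso. apply Hm. simpl. auto.
        + apply Cmult_0_r. }
    rewrite Hu1, L2norm_const, Rabs_mult, (Rabs_pos_eq (sqrt _)) by lra.
    apply Rmult_le_compat_l; [lra|].
    replace (Rabs (sin (mu * tau))) with (Rabs (Im (expi (- (mu * tau)) - RtoC 1)%C)).
    + apply Im_le_Cmod.
    + unfold Im, expi; simpl. rewrite Ropp_0, Rplus_0_r, sin_neg. apply Rabs_Ropp.
Qed.

(** * The cnoidal wave and its Fourier coefficients *)

(** The algebra generated by the three functions is closed under differentiation. With syntax for
    it, one induction each yields smoothness, boundedness and periodicity of all derivatives of the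
    profile. *)
Inductive elliptic_polynomial : Type :=
| Sn | Cn | Dn
| Cst (k : R)
| Add (e e' : elliptic_polynomial)
| Mul (e e' : elliptic_polynomial).

Section EllipticPolynomials.

Variables (lam : R) (s c d : R -> R).

Fixpoint eval (e : elliptic_polynomial) (x : R) : R :=
  match e with
  | Sn => s x | Cn => c x | Dn => d x | Cst k => k
  | Add e e' => eval e x + eval e' x
  | Mul e e' => eval e x * eval e' x
  end.

Fixpoint derivative (e : elliptic_polynomial) : elliptic_polynomial :=
  match e with
  | Sn => Mul (Cst lam) (Mul Cn Dn)
  | Cn => Mul (Cst (- lam)) (Mul Sn Dn)
  | Dn => Mul (Cst (- lam / 2)) (Mul Sn Cn)
  | Cst _ => Cst 0
  | Add e e' => Add (derivative e) (derivative e')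
  | Mul e e' => Add (Mul (derivative e) e') (Mul e (derivative e'))
  end.

Lemma is_derive_eval (e : elliptic_polynomial) :
  (forall x, is_derive s x (lam * c x * d x)) ->
  (forall x, is_derive c x (- lam * s x * d x)) ->
  (forall x, is_derive d x (- lam / 2 * s x * c x)) ->
  forall x, is_derive (eval e) x (eval (derivative e) x).
Proof.
  intros Hs Hc Hd x. induction e; simpl.
  - eapply is_derive_eq; [apply Hs|ring].
  - eapply is_derive_eq; [apply Hc|ring].
  - eapply is_derive_eq; [apply Hd|field].
  - apply (is_derive_const (V := R_NormedModule)).
  - now apply (is_derive_plus (V := R_NormedModule)).
  - apply (is_derive_mult (eval e1) (eval e2)); try easy. intros; apply Rmult_comm.
Qed.

Lemma eval_bounded (e : elliptic_polynomial) :
  (forall x, s x ^ 2 + c x ^ 2 = 1) -> (forall x, d x ^ 2 + s x ^ 2 / 2 = 1) ->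
  exists M, forall x, Rabs (eval e x) <= M.
Proof.
  intros Hsc Hds.
  assert (Hsq : forall y, y ^ 2 <= 1 -> Rabs y <= 1)
    by (intros; apply Rabs_le; nra).
  induction e as [| | |k|e [M HM] e' [M' HM']|e [M HM] e' [M' HM']]; simpl.
  - exists 1. intros x. apply Hsq. generalize (Hsc x). nra.
  - exists 1. intros x. apply Hsq. generalize (Hsc x). nra.
  - exists 1. intros x. apply Hsq. generalize (Hds x). nra.
  - exists (Rabs k). intros _. apply Rle_refl.
  - exists (M + M'). intros x. eapply Rle_trans; [apply Rabs_triang|].
    now apply Rplus_le_compat.
  - exists (M * M'). intros x. rewrite Rabs_mult.
    apply Rmult_le_compat; try easy; apply Rabs_pos.
Qed.

Lemma eval_periodic (e : elliptic_polynomial) (p : R) :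
  (forall x, s (x + p) = s x /\ c (x + p) = c x /\ d (x + p) = d x) ->
  forall x, eval e (x + p) = eval e x.
Proof.
  intros Hp x. destruct (Hp x) as (H1 & H2 & H3).
  induction e; simpl; congruence.
Qed.

End EllipticPolynomials.

(* [phi O (x - v t)] is a cnoidal wave, [phi O = 6 lam^2 s^2 + be]; the constant
   [be] makes its mean zero. *)
Lemma cnoidal_profile :
  exists (phi : nat -> R -> R) (v : R),
    (forall n x, is_derive (phi n) x (phi (S n) x)) /\
    (forall n x, phi n (x + 2 * PI) = phi n x) /\
    (forall n, exists M, forall x, Rabs (phi n x) <= M) /\
    RInt (phi O) 0 (2 * PI) = 0 /\
    (forall x, - v * phi 1%nat x + phi 3%nat x = phi O x * phi 1%nat x) /\
    (forall k, ~ forall x, phi 2%nat x = k * phi O x).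
Proof.
  destruct elliptic_functions as (lam & s & c & d & Hlam & Hs & Hc & Hd & Hsc & Hds & Hp & Hsin).
  (* The factor [6 * lam ^ 2] makes the [s ^ 4] terms of [phi''] and [phi ^ 2 / 2] agree: both have
     coefficient [18 * lam ^ 4]. *)
  set (e0 := Mul (Cst (6 * lam ^ 2)) (Mul Sn Sn)).
  set (I0 := RInt (eval s c d e0) 0 (2 * PI) : R).
  set (be := - / (2 * PI) * I0).
  set (e1 := Add e0 (Cst be)).
  set (phi := fun n => eval s c d (Nat.iter n (derivative lam) e1)).
  assert (Hd' : forall e x, is_derive (eval s c d e) x (eval s c d (derivative lam e) x))
    by (intros; now apply is_derive_eval).
  (* Eliminating [c] and [d] leaves a quadratic polynomial in [s ^ 2], used both for the wave
     equation and to exclude sinusoids. *)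
  assert (H2 : forall x, phi 2%nat x = 6 * lam ^ 4 * (2 - 6 * s x ^ 2 + 3 * s x ^ 4)).
  { intros x.
    assert (E1 : c x ^ 2 = 1 - s x ^ 2) by (generalize (Hsc x); lra).
    assert (E2 : d x ^ 2 = 1 - s x ^ 2 / 2) by (generalize (Hds x); lra).
    transitivity (6 * lam ^ 4 * (2 * (c x ^ 2) * (d x ^ 2) - 2 * s x ^ 2 * (d x ^ 2) - s x ^ 2 * (c x ^ 2))).
    - unfold phi; simpl. field.
    - rewrite E1, E2. field. }
  (* Since [phi''' = 6 lam ^ 2 (s ^ 2 - 1) phi'], the difference [phi''' - phi phi'] is [phi'] times
     this constant. *)
  exists phi, (- 6 * lam ^ 2 - be).
  split; [|split; [|split; [|split; [|split]]]].
  - intros n x. apply Hd'.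
  - intros n x. now apply eval_periodic.
  - intros n. apply eval_bounded; easy.
  - assert (Hc0 : forall x, continuous (eval s c d e0) x)
      by (intros; eapply is_derive_continuous, Hd').
    rewrite (RInt_Rlin _ (eval s c d e0) (fun _ => 1) 1 be); [|intros; unfold phi; simpl; ring|easy|intros; apply continuous_const].
    fold I0. rewrite RInt_const. unfold scal; simpl; unfold mult; simpl.
    unfold be. generalize PI_RGT_0. intros.
    match goal with |- ?l = _ => change (@eq R l 0) end. field. lra.
  - intros x.
    assert (H3 : is_derive (phi 2%nat) x (6 * lam ^ 4 * (- 12 * s x + 12 * s x ^ 3) * (lam * c x * d x))).
    { apply (is_derive_ext (fun x => 6 * lam ^ 4 * (2 - 6 * s x ^ 2 + 3 * s x ^ 4)));
        [intros; now rewrite H2|].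
      assert (Hsx : Derive (fun x => s x) x = lam * c x * d x) by exact (is_derive_unique s _ _ (Hs x)).
      assert (Hex : ex_derive s x) by (eexists; apply Hs).
      auto_derive; [tauto|].
      rewrite Hsx. ring. }

    assert (E3 : phi 3%nat x = 6 * lam ^ 4 * (- 12 * s x + 12 * s x ^ 3) * (lam * c x * d x)).
    { rewrite <- (is_derive_unique _ _ _ H3). symmetry. apply is_derive_unique, Hd'. }
    rewrite E3. unfold phi; simpl. ring.
  - intros k Hk.
    (* [k * phi] is affine in [s ^ 2] while [phi''] is strictly quadratic in it; the equally spaced
       values 0, 1/2, 1 of [s ^ 2] tell them apart. *)
    destruct (Hsin 0) as [x0 E0]. destruct (Hsin (PI / 2)) as [x1 E1].
    destruct (Hsin (PI / 4)) as [x2 E2].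
    rewrite sin_0 in E0. rewrite sin_PI2 in E1. rewrite sin_PI4 in E2.
    assert (Hq : s x2 ^ 2 = 1 / 2).
    { rewrite E2. unfold Rdiv. rewrite Rpow_mult_distr, pow_inv, pow2_sqrt by lra. field. }
    assert (K0 := Hk x0). assert (K1 := Hk x1). assert (K2 := Hk x2).
    rewrite H2 in K0, K1, K2.
    assert (P0 : forall x, phi O x = 6 * lam ^ 2 * s x ^ 2 + be) by (intros; unfold phi; simpl; ring).
    rewrite P0 in K0, K1, K2. replace (s x2 ^ 4) with ((s x2 ^ 2) ^ 2) in K2 by ring.
    rewrite Hq in K2. rewrite E0 in K0. rewrite E1 in K1.
    assert (0 < lam ^ 4) by (apply pow_lt; easy). nra.
Qed.

Lemma KdV_travelling_wave (phi : nat -> R -> R) (v T : R) :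
  (forall n x, is_derive (phi n) x (phi (S n) x)) ->
  (forall x, phi O (x + 2 * PI) = phi O x) ->
  RInt (phi O) 0 (2 * PI) = 0 ->
  (forall x, - v * phi 1%nat x + phi 3%nat x = phi O x * phi 1%nat x) ->
  KdV_smooth_solution T (fun t x => RtoC (phi O (x + - (v * t)))).
Proof.
  intros Hd Hp H0 Heq.
  assert (Hc : forall n x, continuous (phi n) x) by (intros; eapply is_derive_continuous, Hd).
  assert (Hdx : forall n y x, is_derive (fun x => phi n (x + y)) x (phi (S n) (x + y))).
  { intros n y x. apply is_derive_eq with (1 * phi (S n) (x + y)); [|ring].
    apply (is_derive_comp (phi n) (fun x => x + y)); [apply Hd|].
    auto_derive; [easy|ring]. }
  split; [|split; [|split]].
  - intros t x _. rewrite <- (Hp (x + - (v * t))). do 2 f_equal. ring.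
  - now intros.
  - intros t _.
    rewrite (CInt_periodic_comp (fun x => RtoC (phi O x))).
    + rewrite CInt_RtoC by auto. exact (f_equal RtoC H0).
    + apply Ccont_RtoC; auto.
    + intros y. now rewrite Hp.
  (* Each time derivative of the wave is [- v] times a space derivative. *)
  - exists (fun j k t x => RtoC ((- v) ^ j * phi (j + k)%nat (x + - (v * t)))). split.
    + apply smooth_with_derivatives_intro.
      * intros t x. now rewrite Rmult_1_l.
      * intros j k t x. split; [|split].
        -- apply is_derive_C; [|apply (is_derive_const (V := R_NormedModule))].
           apply is_derive_eq with ((- v) ^ j * (- v * phi (S (j + k)) (x + - (v * t)))).
           ++ apply (is_derive_scal (fun s => phi (j + k)%nat (x + - (v * s)))).
              apply (is_derive_comp (phi (j + k)%nat) (fun s => x + - (v * s))); [apply Hd|].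
              auto_derive; [easy|ring].
           ++ rewrite Nat.add_1_r. simpl. ring.
        -- apply is_derive_C; [|apply (is_derive_const (V := R_NormedModule))].
           replace (j + (k + 1))%nat with (S (j + k)) by lia.
           apply (is_derive_scal (fun x => phi (j + k)%nat (x + - (v * t)))), Hdx.
        -- apply (continuous_comp (U := prod_UniformSpace R_UniformSpace R_UniformSpace)
             (fun z => snd z + - (v * fst z)) (fun y => RtoC ((- v) ^ j * phi (j + k)%nat y))).
           ++ apply (continuous_plus (V := R_NormedModule)); [apply continuous_snd|].
              apply (continuous_opp (V := R_NormedModule)).
              apply (continuous_scal_r (V := R_NormedModule)), continuous_fst.
           ++ apply (ex_derive_continuous (V := C_R_NormedModule)). eexists.
              apply is_derive_C; [|apply (is_derive_const (V := R_NormedModule))].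
              apply (is_derive_scal (phi (j + k)%nat)), Hd.
    + intros t x _. set (y := - (v * t)).
      exists (RtoC (2 * (phi O (x + y) * phi 1%nat (x + y)))). split.
      * apply (is_derive_ext (V := C_R_NormedModule) (fun x => RtoC (phi O (x + y) * phi O (x + y)))).
        -- intros z. apply RtoC_mult.
        -- apply is_derive_C; [|apply (is_derive_const (V := R_NormedModule))].
           apply is_derive_eq with (phi 1%nat (x + y) * phi O (x + y) + phi O (x + y) * phi 1%nat (x + y)); [|ring].
           apply (is_derive_mult (fun x => phi O (x + y)) (fun x => phi O (x + y)));
             [apply Hdx|apply Hdx|intros; apply Rmult_comm].
      * apply injective_projections; simpl; [|ring].
        generalize (Heq (x + y)). unfold y. lra.
Qed.

(** * Fourier coefficients of smooth periodic functions *)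

Lemma fourier_second_derivative (f f' f'' : R -> R) (m : Z) :
  (forall x, is_derive f x (f' x)) -> (forall x, is_derive f' x (f'' x)) ->
  (forall x, continuous f'' x) ->
  (forall x, f (x + 2 * PI) = f x) -> (forall x, f' (x + 2 * PI) = f' x) ->
  fourier (fun x => RtoC (f'' x)) m = (- RtoC (IZR m ^ 2) * fourier (fun x => RtoC (f x)) m)%C.
Proof.
  intros Hf Hf' Hc Hp Hp'. set (k := IZR m).
  assert (Cf : forall x, continuous f x) by (intros; eapply is_derive_continuous, Hf).
  assert (E : fourier (fun x => RtoC (f'' x) + RtoC (k ^ 2) * RtoC (f x))%C m = RtoC 0).
  { assert (Hcc : Ccont (fun x => RtoC (f'' x) + RtoC (k ^ 2) * RtoC (f x))%C).
    { apply Ccont_plus; [now apply Ccont_RtoC|].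
      apply Ccont_mult; [apply Ccont_const|now apply Ccont_RtoC]. }
    assert (Hm := Ccont_mode m _ Hcc).
    unfold fourier. rewrite CInt_pair by exact Hm.
    assert (E0 := expi_period 0 m). rewrite expi_0, Rplus_0_l in E0. fold k in E0.
    unfold expi, RtoC in E0. injection E0 as Ec Es.
    assert (Q0 : f (2 * PI) = f 0) by (rewrite <- (Hp 0); f_equal; ring).
    assert (Q1 : f' (2 * PI) = f' 0) by (rewrite <- (Hp' 0); f_equal; ring).
    assert (D1 : forall x, Derive (fun x => f x) x = f' x)
      by (intros x; exact (is_derive_unique f _ _ (Hf x))).
    assert (D2 : forall x, Derive (fun x => f' x) x = f'' x)
      by (intros x; exact (is_derive_unique f' _ _ (Hf' x))).
    (* Both integrations by parts at once: [F] and [G] are primitives of the real and imaginary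
       parts of [exp (- i k x) (f'' + k ^ 2 f)]. *)
    set (F := fun x => cos (k * x) * f' x + k * sin (k * x) * f x).
    set (G := fun x => k * cos (k * x) * f x - sin (k * x) * f' x).
    assert (EF : F (2 * PI) - F 0 = 0)
      by (unfold F; rewrite Ec, Es, Q0, Q1, Rmult_0_r, cos_0, sin_0; ring).
    assert (EG : G (2 * PI) - G 0 = 0)
      by (unfold G; rewrite Ec, Es, Q0, Q1, Rmult_0_r, cos_0, sin_0; ring).
    rewrite (is_RInt_unique (V := R_CompleteNormedModule) _ 0 (2 * PI) (F (2 * PI) - F 0)).
    - rewrite (is_RInt_unique (V := R_CompleteNormedModule) _ 0 (2 * PI) (G (2 * PI) - G 0)).
      + rewrite EF, EG. apply Cmult_0_r.
      + apply (is_RInt_derive (V := R_CompleteNormedModule) G).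
        * intros x _. fold k. unfold G. auto_derive.
          -- split; [now exists (f' x)|split; [now exists (f'' x)|easy]].
          -- rewrite D1, D2.
             simpl. rewrite sin_neg. ring.
        * intros x _. exact (proj2 (Hm x)).
    - apply (is_RInt_derive (V := R_CompleteNormedModule) F).
      + intros x _. fold k. unfold F. auto_derive.
        * split; [now exists (f'' x)|split; [now exists (f' x)|easy]].
        * rewrite D1, D2.
          simpl. rewrite cos_neg. ring.
      + intros x _. exact (proj1 (Hm x)). }
  rewrite fourier_lin in E by now apply Ccont_RtoC.
  replace (fourier (fun x => RtoC (f'' x)) m) with (fourier (fun x => RtoC (f'' x)) m
    + RtoC (k ^ 2) * fourier (fun x => RtoC (f x)) m - RtoC (k ^ 2) * fourier (fun x => RtoC (f x)) m)%C by ring.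
  rewrite E. ring.
Qed.

Lemma fourier_decay (f f' f'' : R -> R) (M : R) :
  (forall x, is_derive f x (f' x)) -> (forall x, is_derive f' x (f'' x)) ->
  (forall x, continuous f'' x) ->
  (forall x, f (x + 2 * PI) = f x) -> (forall x, f' (x + 2 * PI) = f' x) ->
  (forall x, Rabs (f'' x) <= M) ->
  inverse_square_decay (2 * M) (fourier (fun x => RtoC (f x))).
Proof.
  intros Hf Hf' Hc Hp Hp' HM m Hm.
  assert (Hk : 0 < IZR m ^ 2) by (apply pow2_gt_0, not_0_IZR; easy).
  assert (B : Cmod (fourier (fun x => RtoC (f'' x)) m) <= 2 * M).
  { apply fourier_bound; [now apply Ccont_RtoC|]. intros x. now rewrite Cmod_R. }
  rewrite (fourier_second_derivative f f' f'' m) in B by easy.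
  rewrite Cmod_mult, Cmod_opp, Cmod_R, Rabs_pos_eq in B by lra.
  apply Rmult_le_reg_l with (IZR m ^ 2); [easy|].
  replace (IZR m ^ 2 * (2 * M * / IZR m ^ 2)) with (2 * M) by (field; now apply not_0_IZR).
  exact B.
Qed.

Lemma fourier_translate (u : R -> C) (y : R) (m : Z) :
  Ccont u -> (forall x, u (x + 2 * PI) = u x) ->
  fourier (fun x => u (x + y)) m = (expi (IZR m * y) * fourier u m)%C.
Proof.
  intros Hu Hp. unfold fourier.
  rewrite <- (CInt_periodic_comp (fun x => expi (- (IZR m * x)) * u x)%C (2 * PI) y).
  - rewrite (CInt_ext _ (fun x => expi (IZR m * y) * (expi (- (IZR m * (x + y))) * u (x + y)%R))%C).
    + rewrite CInt_scal; [ring|].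
      apply (Ccont_comp (fun x => expi (- (IZR m * x)) * u x)%C); [now apply Ccont_mode|].
      intros x. apply continuous_Rplus; [apply continuous_id|apply continuous_const].
    + intros x. replace (- (IZR m * x)) with (IZR m * y + - (IZR m * (x + y))) by ring.
      rewrite expi_plus. ring.
  - now apply Ccont_mode.
  - intros x. rewrite Hp. f_equal. rewrite <- (expi_period (- (IZR m * x)) (- m)).
    f_equal. rewrite opp_IZR. ring.
Qed.

(** * Estimates for the L2 norm *)

(** Expands the nonnegative integral of [(f - A / p) ^ 2], where [A / p] is the mean of [f]. *)
Lemma RInt_Cauchy_Schwarz (f : R -> R) (p : R) :
  0 < p -> (forall x, continuous f x) ->
  RInt f 0 p ^ 2 <= p * RInt (fun x => f x ^ 2) 0 p.
Proof.
  intros Hp Hf. set (A := RInt f 0 p).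
  assert (Hf2 : forall x, continuous (fun x => f x ^ 2) x).
  { intros x. apply (continuous_ext (fun x => f x * f x)); [intros; simpl; ring|].
    now apply continuous_Rmult. }
  assert (Hc : forall x, continuous (fun x => -2 * (A / p) * f x + (A / p) ^ 2 * 1) x).
  { intros x. apply continuous_Rplus; [|apply continuous_const].
    apply continuous_Rmult; [apply continuous_const|easy]. }
  assert (E : RInt (fun x => (f x - A / p) ^ 2) 0 p =
    RInt (fun x => f x ^ 2) 0 p - A ^ 2 / p).
  { rewrite (RInt_Rlin _ (fun x => f x ^ 2) (fun x => -2 * (A / p) * f x + (A / p) ^ 2 * 1) 1 1);
      [|intros; simpl; ring|easy|easy].
    rewrite (RInt_Rlin (fun x => -2 * (A / p) * f x + (A / p) ^ 2 * 1) f (fun _ => 1)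
      (-2 * (A / p)) ((A / p) ^ 2)); [|easy|easy|intros; apply continuous_const].
    fold A. rewrite RInt_const. unfold scal; simpl; unfold mult; simpl. field. lra. }
  assert (H : 0 <= RInt (fun x => (f x - A / p) ^ 2) 0 p).
  { apply RInt_ge_0; [lra| |intros; apply pow2_ge_0].
    apply continuous_ex_RInt. intros x.
    apply (continuous_ext (fun x => (f x - A / p) * (f x - A / p))); [intros; simpl; ring|].
    apply continuous_Rmult; apply continuous_Rminus; try easy; apply continuous_const. }
  rewrite E in H.
  assert (A ^ 2 / p * p = A ^ 2) by (field; lra). nra.
Qed.

Lemma fourier_le_L2norm (u : R -> C) (m : Z) : Ccont u -> Cmod (fourier u m) <= 2 * L2norm u.
Proof.
  intros Hu. assert (HPI := PI2_1). assert (HPI' := PI_RGT_0).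
  assert (Hm := Ccont_mode m u Hu).
  set (Q := RInt (fun x => Cmod (u x) ^ 2) 0 (2 * PI)).
  assert (Hr : forall f : R -> R, (forall x, continuous f x) ->
    (forall x, Rabs (f x) <= Cmod (u x)) -> Rabs (RInt f 0 (2 * PI)) <= 2 * PI * L2norm u).
  { intros f Hf Hfu.
    assert (H := RInt_Cauchy_Schwarz f (2 * PI) ltac:(lra) Hf).
    assert (HQ : RInt (fun x => f x ^ 2) 0 (2 * PI) <= Q).
    { apply RInt_le; [lra| | |].
      - apply continuous_ex_RInt. intros x.
        apply (continuous_ext (fun x => f x * f x)); [intros; simpl; ring|].
        now apply continuous_Rmult.
      - apply continuous_ex_RInt. now apply Ccont_Cmod_sq.
      - intros x _. rewrite <- pow2_abs. apply pow_incr. split; [apply Rabs_pos|easy]. }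
    assert (HQ0 : 0 <= Q).
    { apply RInt_ge_0; [lra| |intros; apply pow2_ge_0].
      apply continuous_ex_RInt. now apply Ccont_Cmod_sq. }
    assert (HL : L2norm u ^ 2 = Q) by (unfold L2norm; now apply pow2_sqrt).
    assert (HL0 : 0 <= L2norm u) by apply sqrt_pos.

    (* Cauchy-Schwarz bounds the square by [2 * PI * Q]; as [2 * PI >= 1], this is at most
       [(2 * PI) ^ 2 * Q]. *)
    apply Rsqr_incr_0; [|apply Rabs_pos|nra].
    unfold Rsqr. 
    replace (Rabs (RInt f 0 (2 * PI)) * Rabs (RInt f 0 (2 * PI))) with (RInt f 0 (2 * PI) ^ 2)
      by (rewrite <- pow2_abs; simpl; ring).
    replace (2 * PI * L2norm u * (2 * PI * L2norm u)) with (2 * PI * (2 * PI * Q))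
      by (rewrite <- HL; simpl; ring).
    apply Rle_trans with (1 := H). apply Rmult_le_compat_l; [lra|]. nra. }
  unfold fourier. rewrite Cmod_mult, Cmod_R, Rabs_pos_eq by (apply Rlt_le, Rinv_0_lt_compat; lra).
  apply Rmult_le_reg_l with (2 * PI); [lra|].
  rewrite <- Rmult_assoc, Rinv_r, Rmult_1_l by lra.
  rewrite CInt_pair by easy.
  eapply Rle_trans; [apply Cmod_le_Rabs|].
  assert (Hb : forall x, Cmod (expi (- (IZR m * x)) * u x) = Cmod (u x))
    by (intros x; rewrite Cmod_mult, Cmod_expi; apply Rmult_1_l).
  assert (H1 := Hr (fun x => Re (expi (- (IZR m * x)) * u x)%C) (fun x => proj1 (Hm x))).
  assert (H2 := Hr (fun x => Im (expi (- (IZR m * x)) * u x)%C) (fun x => proj2 (Hm x))).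
  assert (H1' := H1 ltac:(intros x; rewrite <- Hb; apply Re_le_Cmod)).
  assert (H2' := H2 ltac:(intros x; rewrite <- Hb; apply Im_le_Cmod)).
  lra.
Qed.

(** Periodicity moves the interval so that it starts at [x]; a positive value there then gives
    positive mass just to the right of [x], with no case distinction on its position. *)
Lemma RInt_nonneg_eq_0 (g : R -> R) (p : R) :
  0 < p -> (forall x, continuous g x) -> (forall x, 0 <= g x) ->
  (forall x, g (x + p) = g x) -> RInt g 0 p = 0 -> forall x, g x = 0.
Proof.
  intros Hp Hc Hpos Hper H0 x.
  assert (Hle : forall y z, y <= z -> 0 <= RInt g y z)
    by (intros; apply RInt_ge_0; auto; now apply continuous_ex_RInt).
  destruct (Rle_lt_or_eq_dec 0 (g x) (Hpos x)) as [Hx|]; [exfalso|easy].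
  destruct (proj1 (filterlim_locally g (g x)) (Hc x) (mkposreal _ Hx)) as [delta Hdelta].
  set (e := Rmin (delta / 2) p).
  assert (He : 0 < e <= p /\ e < delta).
  { generalize (cond_pos delta) (Rmin_l (delta / 2) p) (Rmin_r (delta / 2) p).
    fold e. intros. split; [split|]; try lra. apply Rmin_glb_lt; lra. }
  assert (H1 : 0 < RInt g x (x + e)).
  { apply RInt_gt_0; [lra| |intros; apply Hc].
    intros y Hy. assert (H := Hdelta y).
    assert (Hb : ball x delta y) by (change (Rabs (y - x) < delta); rewrite Rabs_pos_eq; lra).
    specialize (H Hb). change (Rabs (g y - g x) < g x) in H.
    apply Rabs_def2 in H. lra. }
  assert (H2 := Hle (x + e) (x + p) ltac:(lra)).
  assert (E := RInt_Chasles g x (x + e) (x + p) (continuous_ex_RInt _ _ _ Hc) (continuous_ex_RInt _ _ _ Hc)).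
  unfold plus in E; simpl in E.
  rewrite (RInt_periodic_shift g p Hc Hper), H0 in E. lra.
Qed.

Lemma L2norm_eq_0 (u : R -> C) :
  Ccont u -> (forall x, u (x + 2 * PI) = u x) -> L2norm u = 0 -> forall x, u x = RtoC 0.
Proof.
  intros Hu Hp H0 x. assert (HPI := PI_RGT_0).
  assert (H : Cmod (u x) ^ 2 = 0).
  { apply (RInt_nonneg_eq_0 (fun x => Cmod (u x) ^ 2) (2 * PI)); [lra| | | |].
    - now apply Ccont_Cmod_sq.
    - intros; apply pow2_ge_0.
    - intros y. now rewrite Hp.
    - apply sqrt_eq_0; [|easy]. apply RInt_ge_0; [lra| |intros; apply pow2_ge_0].
      apply continuous_ex_RInt. now apply Ccont_Cmod_sq. }
  apply Cmod_eq_0. nra.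
Qed.

Lemma L2norm_translate (u : R -> C) (y : R) :
  Ccont u -> (forall x, u (x + 2 * PI) = u x) -> L2norm (fun x => u (x + y)) = L2norm u.
Proof.
  intros Hu Hp. unfold L2norm. f_equal.
  apply (RInt_periodic_comp (fun x => Cmod (u x) ^ 2)).
  - now apply Ccont_Cmod_sq.
  - intros x. now rewrite Hp.
Qed.

Lemma trigonometric_polynomial_period (L : list Z) (g : Z -> C) (x : R) :
  csum L (fun m => expi (IZR m * (x + 2 * PI)) * g m)%C = csum L (fun m => expi (IZR m * x) * g m)%C.
Proof.
  apply csum_ext. intros m _. f_equal. rewrite <- (expi_period (IZR m * x) m). f_equal. ring.
Qed.

Lemma Ccont_trigonometric_polynomial (L : list Z) (g : Z -> C) :
  Ccont (fun x => csum L (fun m => expi (IZR m * x) * g m)%C).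
Proof.
  apply (Ccont_csum L (fun m x => expi (IZR m * x) * g m)%C).
  intros m. apply Ccont_mult; [apply Ccont_expi|apply Ccont_const].
Qed.

(** * Travelling waves followed by the linear KdV flow *)

Lemma travelling_wave_dispersion (w : R -> C) (v K : R) (u1 : R -> R -> C) (m : Z) :
  Ccont w -> (forall x, w (x + 2 * PI) = w x) ->
  0 <= K -> inverse_square_decay K (fourier w) ->
  at_right 0 (fun tau => KdV_flow tau w (u1 tau)) ->
  filterlim (fun tau => L2norm (fun x => w (x + - (v * tau))%R - u1 tau x)%C / tau)
    (at_right 0) (locally 0) ->
  fourier w m <> RtoC 0 -> IZR m * (IZR m ^ 2 + v) = 0.
Proof.
  intros Hw Hp HK Hdec Hflow Hlim Hm.
  set (q := Cmod (fourier w m)).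
  assert (Hq : 0 < q) by now apply Cmod_gt_0.
  set (k := IZR m).
  assert (H0 : q * / 2 * (k * (- v) - k ^ 3) = 0).
  (* The [m]-th coefficient of the error is [fourier w m] times a difference of two exponentials, of
     which the imaginary part is kept. The [/ 2] offsets the factor in [fourier_le_L2norm]. *)
  { refine (is_derive_bounded_by_little_o
      (fun tau => q * / 2 * (sin (k * (- v) * tau) - sin (k ^ 3 * tau))) _ _ _ _ _ Hlim).
    - auto_derive; [easy|]. rewrite !Rmult_0_r, cos_0. ring.
    - rewrite !Rmult_0_r, sin_0. ring.
    - revert Hflow. apply filter_imp. intros tau Hflow.
      destruct (trigonometric_series K (fun j => expi (tau * IZR j ^ 3) * fourier w j)%C (u1 tau))
        as [Hc Hf]; [easy| | |].
      + intros j Hj. rewrite Cmod_mult, Cmod_expi, Rmult_1_l. now apply Hdec.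
      + intros x eps Heps. destruct (Hflow x eps Heps) as [L0 [HL0 H]]. exists L0.
        split; [easy|]. intros L H1 H2 H3.
        erewrite map_ext; [apply (H L H1 H2 H3)|]. intros j. apply Cmult_assoc.
      + assert (Hs : forall x, continuous (fun x => x + - (v * tau)) x).
        { intros x. apply continuous_Rplus; [apply continuous_id|apply continuous_const]. }
        assert (Hws := Ccont_comp w _ Hw Hs).
        assert (B := fourier_le_L2norm _ m (Ccont_minus _ _ Hws Hc)).
        rewrite fourier_minus, Hf, fourier_translate in B by easy.
        assert (B' : Rabs (sin (k * (- v) * tau) - sin (k ^ 3 * tau)) * q <=
          2 * L2norm (fun x => w (x + - (v * tau))%R - u1 tau x)%C).
        { eapply Rle_trans; [|exact B].
          replace (expi (IZR m * - (v * tau)) * fourier w m - expi (tau * IZR m ^ 3) * fourier w m)%C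
            with ((expi (IZR m * - (v * tau)) - expi (tau * IZR m ^ 3)) * fourier w m)%C by ring.
          rewrite Cmod_mult. apply Rmult_le_compat_r; [now apply Rlt_le|].
          eapply Rle_trans; [|apply Im_le_Cmod]. right. unfold k. f_equal.
          simpl. unfold Rminus. f_equal; [|f_equal]; f_equal; ring. }
        rewrite Rabs_mult, (Rabs_pos_eq (q * / 2)) by lra. lra. }
  assert (k * (- v) - k ^ 3 = 0); [|fold k; lra].
  apply Rmult_integral in H0. destruct H0; [lra|easy].
Qed.

Lemma travelling_wave_sinusoidal (w : R -> C) (v K : R) (u1 : R -> R -> C) :
  Ccont w -> (forall x, w (x + 2 * PI) = w x) -> fourier w 0 = RtoC 0 ->
  0 <= K -> inverse_square_decay K (fourier w) ->
  at_right 0 (fun tau => KdV_flow tau w (u1 tau)) ->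
  filterlim (fun tau => L2norm (fun x => w (x + - (v * tau))%R - u1 tau x)%C / tau)
    (at_right 0) (locally 0) ->
  exists (n : Z) (A B : C), forall x,
    w x = (expi (IZR n * x) * A + expi (IZR (- n) * x) * B)%C.
Proof.
  intros Hw Hp Hw0 HK Hdec Hflow Hlim.
  assert (Hdisp : forall m, fourier w m <> RtoC 0 -> m <> 0%Z /\ IZR m ^ 2 = - v).
  { intros m Hm. assert (H := travelling_wave_dispersion w v K u1 m Hw Hp HK Hdec Hflow Hlim Hm).
    assert (Hm0 : m <> 0%Z) by (intros ->; now apply Hm). split; [easy|].
    apply Rmult_integral in H. destruct H as [H|H]; [now apply eq_IZR in H|lra]. }
  (* If every coefficient vanishes, any nonzero frequency serves, hence the witness 1. Excluding 0
     keeps [n] and [- n] distinct in the list [L]. *)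
  assert (Hn : exists n, n <> 0%Z /\ forall m, fourier w m <> RtoC 0 -> m = n \/ m = (- n)%Z).
  { destruct (classic (exists n, fourier w n <> RtoC 0)) as [[n Hn]|Hn].
    - exists n. split; [now apply Hdisp|]. intros m Hm.
      apply Hdisp in Hn as [_ En]. apply Hdisp in Hm as [_ Em].
      assert (E : (m * m = n * n)%Z) by (apply eq_IZR; rewrite !mult_IZR; nra).
      assert (((m - n) * (m + n) = 0)%Z) by lia.
      apply Z.mul_eq_0 in H. lia.
    - exists 1%Z. split; [easy|]. intros m Hm. exfalso. now apply Hn; exists m. }
  destruct Hn as (n & Hn0 & Hn). exists n, (fourier w n), (fourier w (- n)).
  set (L := n :: (- n)%Z :: nil).
  assert (HL : NoDup L).
  { repeat constructor; simpl; try tauto. intros [H|[]]. lia. }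
  set (Tr := fun x => csum L (fun m => expi (IZR m * x) * fourier w m)%C).
  set (W := fun x => (w x - Tr x)%C).
  assert (HW : Ccont W) by (apply Ccont_minus; [easy|apply Ccont_trigonometric_polynomial]).
  assert (HWp : forall x, W (x + 2 * PI) = W x).
  { intros x. unfold W. f_equal; [apply Hp|]. unfold Tr.
    now rewrite trigonometric_polynomial_period. }
  (* On the surviving modes [m ^ 2 = - v], so the phase [tau * m ^ 3] equals [- m * v * tau]: the
     flow output is [Tr] translated by [v * tau], and the error is the translate of [W]. *)
  assert (Hu1 : at_right 0 (fun tau =>
      L2norm (fun x => w (x + - (v * tau))%R - u1 tau x)%C = L2norm W)).
  { revert Hflow. apply filter_imp. intros tau Hflow.
    rewrite <- (L2norm_translate W (- (v * tau)) HW HWp). f_equal.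
    apply functional_extensionality. intros x. unfold W. f_equal. f_equal.
    rewrite (fun Hf => has_sum_csum_eq L _ _ HL Hf (Hflow x)).
    - apply csum_ext. intros m _.
      destruct (classic (fourier w m = RtoC 0)) as [->|Hm]; [now rewrite !Cmult_0_r|].
      f_equal. rewrite <- expi_plus. f_equal. apply Hdisp in Hm as [_ Hm].
      replace v with (- IZR m ^ 2) by lra. ring.
    - intros m Hm. destruct (classic (fourier w m = RtoC 0)) as [->|Hm']; [apply Cmult_0_r|].
      exfalso. apply Hm. apply Hn in Hm' as [->| ->]; simpl; auto. }
  assert (HL2 : L2norm W = 0).
  (* For [tau < 1] the constant error [L2norm W] dominates [L2norm W * tau], whose slope must then
     vanish. *)
  { refine (is_derive_bounded_by_little_o (fun tau => L2norm W * tau) _ _ _ _ _ Hlim).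
    - auto_derive; [easy|ring].
    - ring.
    - assert (H1 : at_right 0 (fun tau => 0 < tau < 1)).
      { exists (mkposreal 1 Rlt_0_1). intros y Hy Hpos. change (Rabs (y - 0) < 1) in Hy.
        rewrite Rminus_0_r in Hy. generalize (Rle_abs y). lra. }
      generalize (filter_and _ _ Hu1 H1). apply filter_imp. intros tau [-> Htau].
      assert (H := sqrt_pos (RInt (fun x => Cmod (W x) ^ 2) 0 (2 * PI))). fold (L2norm W) in H.
      rewrite Rabs_pos_eq; nra. }
  intros x. assert (H := L2norm_eq_0 W HW HWp HL2 x). unfold W in H.
  replace (w x) with (w x - Tr x + Tr x)%C by ring. rewrite H.
  unfold Tr, csum, L. simpl. ring.
Qed.

Lemma KdV_flow_not_consistent : ~ consistent KdV_smooth_solution KdV_flow.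
Proof.
  intros Hcons.
  destruct cnoidal_profile as (phi & v & Hd & Hp & Hb & H0 & Heq & Hns).
  destruct (Hcons 1 _ Rlt_0_1 (KdV_travelling_wave phi v 1 Hd (Hp O) H0 Heq)) as [u1 [Hflow Hlim]].
  set (w := fun x => RtoC (phi O x)).
  replace (fun x : R => RtoC (phi 0%nat (x + - (v * 0)))) with w in Hflow
    by (apply functional_extensionality; intros x; unfold w; do 2 f_equal; ring).
  assert (Hc : forall n x, continuous (phi n) x) by (intros; eapply is_derive_continuous, Hd).
  destruct (Hb 2%nat) as [M HM].
  assert (HM0 : 0 <= M) by (eapply Rle_trans; [apply Rabs_pos|apply (HM 0)]).
  destruct (travelling_wave_sinusoidal w v (2 * M) u1) as (n & A & B & Hn); try easy.
  - now apply Ccont_RtoC.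
  - intros x. unfold w. now rewrite Hp.
  - unfold fourier. rewrite (CInt_ext _ w).
    + unfold w. rewrite CInt_RtoC by easy. rewrite H0. apply Cmult_0_r.
    + intros x. rewrite Rmult_0_l, Ropp_0, expi_0. apply Cmult_1_l.
  - lra.
  - now apply (fourier_decay (phi O) (phi 1%nat) (phi 2%nat)).
  - apply (Hns (- IZR n ^ 2)).
    set (k := IZR n) in *.
    (* Real parts suffice because the profile is real; differentiating the real sinusoid twice gives
       [phi'' = - n ^ 2 phi]. *)
    set (P := Re A + Re B). set (Q := Im B - Im A).
    assert (E0 : forall x, P * cos (k * x) + Q * sin (k * x) = phi O x).
    { intros x. assert (H := f_equal Re (Hn x)). unfold w in H. rewrite opp_IZR in H. fold k in H.
      simpl in H. rewrite H. rewrite Ropp_mult_distr_l_reverse, cos_neg, sin_neg.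
      unfold P, Q, Re, Im. ring. }
    assert (E1 : forall x, k * (Q * cos (k * x) - P * sin (k * x)) = phi 1%nat x).
    { intros x. rewrite <- (is_derive_unique _ _ _ (Hd O x)). symmetry.
      apply is_derive_unique. apply (is_derive_ext (fun x => P * cos (k * x) + Q * sin (k * x)));
        [exact E0|]. auto_derive; [easy|ring]. }
    intros x. rewrite <- (is_derive_unique _ _ _ (Hd 1%nat x)), <- E0.
    apply is_derive_unique.
    apply (is_derive_ext (fun x => k * (Q * cos (k * x) - P * sin (k * x)))); [exact E1|].
    auto_derive; [easy|ring].
Qed.

Theorem corollary3p16 (S : nat) (c : nat -> R) (b : stage -> R)
    (a : stage -> stage -> R)
    (c_range : forall q, (q <= S)%nat -> 0 <= c q <= 1)
    (symplectic : forall p q r p' q' r' : nat,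
       is_stage S (p, q, r) -> is_stage S (p', q', r') ->
       b (p', q', r') * b (p, q, r) =
         b (p, q, r) * a (p, q, r) (p', q', r') +
         b (p', q', r') * a (p', q', r') (p, q, r)) :
  (KdV_consistent S c b a -> implicit_scheme S a) /\
  (forall (mu : R) (sigma : nat) (gamma : nat -> R),
     mu <> 0 -> is_node_family sigma gamma ->
     NLSE_consistent mu sigma gamma S c b a -> implicit_scheme S a).
Proof.
  split.
  - intros Hcons Hexp. apply KdV_flow_not_consistent.
    exact (explicit_symplectic_consistent_linear _ _ _ _ _ _ _ symplectic Hexp Hcons).
  - intros mu sigma gamma Hmu _ Hcons Hexp. apply (NLSE_flow_not_consistent mu Hmu).
    exact (explicit_symplectic_consistent_linear _ _ _ _ _ _ _ symplectic Hexp Hcons).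
Qed.
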